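(* Let $p$ be an odd prime, let $m\ge 2$ and $1\le l\le m-1$ be integers with $d=\gcd(m,l)>1$, and let $q=p^m$. Let $\mathcal{D}$ be the $\mathbb{F}_p$-linear code of length $p^m$ with coordinates indexed by $\mathbb{F}_q$ given by $\mathcal{D}=\{(\mathrm{Tr}(ax^{p^l+1}+bx)+h)_{x\in\mathbb{F}_q} : a,b\in\mathbb{F}_q,\ h\in\mathbb{F}_p\}$ if $l\ne m/2$, and $\mathcal{D}=\{(\mathrm{Tr}(ax^{p^{m/2}+1}+bx)+h)_{x\in\mathbb{F}_q} : a\in\mathbb{F}_{p^{m/2}},\ b\in\mathbb{F}_q,\ h\in\mathbb{F}_p\}$ if $l=m/2$. For a weight $i$, let $\mathcal{B}_i$ be the set of supports $\{x\in\mathbb{F}_q: c_x\ne 0\}$ of all codewords $c\in\mathcal{D}$ of Hamming weight $i$. Then for each pair $(i,\lambda)$ listed below, $(\mathbb{F}_q,\mathcal{B}_i)$ is a $2$-$(p^m,i,\lambda)$ design. (1) If $m$ and $m/d$ are both odd: $(i,\lambda)=(p^m-p^{m-1},\ (p^m-p^{m-1}-1)(p^{m-1}+1))$; $(i,\lambda)=(p^m-p^{m-1}+p^{\frac{m-1}{2}},\ \frac12 p^{\frac{m-1}{2}}(p^{\frac{m+1}{2}}-p^{\frac{m-1}{2}}+1)(p^m-p^{m-1}+p^{\frac{m-1}{2}}-1))$; $(i,\lambda)=(p^m-p^{m-1}-p^{\frac{m-1}{2}},\ \frac12 p^{\frac{m-1}{2}}(p^{\frac{m+1}{2}}-p^{\frac{m-1}{2}}-1)(p^m-p^{m-1}-p^{\frac{m-1}{2}}-1))$.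 (2) If $m$ is even and $m/d$ is odd: $(i,\lambda)=(p^m-p^{m-1},\ p^m-p^{m-1}-1)$; $(i,\lambda)=(p^{m-1}(p-1)+p^{\frac m2-1},\ \frac12 p^{\frac m2-1}(p^{\frac m2+1}-p^{\frac m2}+1)(p^m-p^{m-1}+p^{\frac m2-1}-1))$; $(i,\lambda)=(p^{m-1}(p-1)-p^{\frac m2-1},\ \frac12 p^{\frac m2-1}(p^{\frac m2+1}-p^{\frac m2}-1)(p^m-p^{m-1}-p^{\frac m2-1}-1))$; $(i,\lambda)=(p^{m-1}(p-1)+p^{\frac m2-1}(p-1),\ \frac12 p^{\frac m2-1}(p^{\frac m2}+1)(p^m-p^{m-1}+p^{\frac m2}-p^{\frac m2-1}-1))$; $(i,\lambda)=(p^{m-1}(p-1)-p^{\frac m2-1}(p-1),\ \frac12 p^{\frac m2-1}(p^{\frac m2}-1)(p^m-p^{m-1}-p^{\frac m2}+p^{\frac m2-1}-1))$. (3) If $m/d\ge 4$ is even, writing $\varepsilon=(-1)^{\frac{m}{2d}}$: $(i,\lambda)=(p^m-p^{m-1},\ (p^m-p^{m-1}-1)(p^{m-d}-p^{m-2d}+1))$; $(i,\lambda)=(p^{m-1}(p-1)+\varepsilon p^{\frac m2-1},\ p^{\frac m2+d-1}(p^{\frac m2+1}-p^{\frac m2}+\varepsilon)(p^m-p^{m-1}+\varepsilon p^{\frac m2-1}-1)/(p^d+1))$; $(i,\lambda)=(p^{m-1}(p-1)-\varepsilon p^{\frac m2-1}(p-1),\ p^{\frac m2+d-1}(p^{\frac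 m2}-\varepsilon)(p^m-p^{m-1}-\varepsilon p^{\frac m2}+\varepsilon p^{\frac m2-1}-1)/(p^d+1))$; $(i,\lambda)=(p^{m-1}(p-1)+\varepsilon p^{\frac m2+d-1}(p-1),\ p^{\frac m2-d-1}(p^{\frac m2-d}+\varepsilon)(p^m-p^{m-1}+\varepsilon p^{\frac m2+d}-\varepsilon p^{\frac m2+d-1}-1)/(p^d+1))$; $(i,\lambda)=(p^{m-1}(p-1)-\varepsilon p^{\frac m2+d-1},\ p^{\frac m2-d-1}(p^{\frac m2-d+1}-p^{\frac m2-d}-\varepsilon)(p^m-p^{m-1}-\varepsilon p^{\frac m2+d-1}-1)/(p^d+1))$. (4) If $m=2d$: $(i,\lambda)=(p^m-p^{m-1},\ p^m-p^{m-1}-1)$; $(i,\lambda)=(p^m-p^{m-1}-p^{\frac m2-1},\ p^{\frac m2-1}(p^{\frac m2+1}-p^{\frac m2}-1)(p^m-p^{m-1}-p^{\frac m2-1}-1)/(p^{\frac m2}+1))$; $(i,\lambda)=(p^m-p^{m-1}+p^{\frac m2}-p^{\frac m2-1},\ p^{\frac m2-1}(p^m-p^{m-1}+p^{\frac m2}-p^{\frac m2-1}-1))$.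
   Context: $\mathrm{Tr}$ is the absolute trace from $\mathbb{F}_q$ to $\mathbb{F}_p$. A $2$-$(v,k,\lambda)$ design is a pair $(\mathcal{P},\mathcal{B})$ where $\mathcal{P}$ is a set of $v$ points and $\mathcal{B}$ is a set of $k$-subsets of $\mathcal{P}$ (blocks) such that every $2$-subset of $\mathcal{P}$ is contained in exactly $\lambda$ blocks. *)

(* Defs.v *)
From HB Require Import structures.
From mathcomp Require Import all_boot all_order all_algebra all_fingroup all_field.
Set Implicit Arguments.
Unset Strict Implicit.
Unset Printing Implicit Defensive.
Import Order.TTheory GRing.Theory Num.Theory.
Local Open Scope ring_scope.

(* The absolute trace x + x^p + ... + x^(p^(m-1)) of F = F_(p^m), read in the
   coefficient field 'F_p: it is the t whose image in F is that sum. By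
   abs_traceE such a t exists when #|F| = p^m, so the default 0 is not used. *)
Definition abs_trace (p m : nat) (F : finFieldType) (x : F) : 'F_p :=
  odflt 0 [pick t : 'F_p | (t : nat)%:R == \sum_(i < m) x ^+ (p ^ i)].

Lemma abs_traceE (p m : nat) (F : finFieldType) (x : F) :
  prime p -> #|F| = (p ^ m)%N ->
  (abs_trace p m x : nat)%:R = \sum_(i < m) x ^+ (p ^ i) :> F.
Proof.
move=> p_pr cardF; have chF := card_finPcharP cardF p_pr.
rewrite /abs_trace; case: pickP => [t /eqP // | no_t].
set y := \sum_(i < m) _ in no_t.
have yp : y ^+ p = y.
  rewrite -(pFrobenius_autE chF) rmorph_sum /=.
  under eq_bigr => i _ do rewrite pFrobenius_autE -exprM -expnSr.
  have h : \sum_(i < m.+1) x ^+ (p ^ i) = y + x.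
    by rewrite big_ord_recr /= -cardF expf_card.
  move: h; rewrite big_ord_recl /= expn0 expr1 [y + x]addrC => /addrI <-.
  by apply: eq_bigr => i _.
pose s := y :: [seq (t : nat)%:R | t : 'F_p].
have s_uniq : uniq s.
  rewrite /s /=; apply/andP; split.
    by apply/imageP => -[t _ yt]; have := no_t t; rewrite -yt eqxx.
  rewrite map_inj_uniq ?enum_uniq // => t u.
  wlog le_tu : t u / (t <= u)%N.
    move=> wl tu; case/orP: (leq_total t u) => le; first exact: wl.
    by apply/esym/wl.
  move/esym/eqP; rewrite -subr_eq0 -natrB // -(dvdn_pcharf chF).
  have lt_u : (u < p)%N by rewrite -[X in (_ < X)%N](Fp_cast p_pr) ltn_ord.
  case: (posnP (u - t)) => [/eqP | pos /dvdn_leq -/(_ pos) le_p].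
    by rewrite subn_eq0 => le_ut _; apply/val_inj/anti_leq; rewrite le_tu.
  by have := leq_ltn_trans (leq_subr t u) lt_u; rewrite ltnNge le_p.
have p_gt1 := prime_gt1 p_pr.
have sz : size ('X^p - 'X : {poly F}) = p.+1.
  by rewrite size_polyDl ?size_polyXn // size_polyN size_polyX ltnS.
have s_roots : all (root ('X^p - 'X)) s.
  rewrite /s /= rootE !hornerE yp subrr eqxx /=; apply/allP => _ /mapP[t _ ->].
  by rewrite rootE !hornerE -(pFrobenius_autE chF) pFrobenius_aut_nat subrr.
have nz : 'X^p - 'X != 0 :> {poly F} by rewrite -size_poly_eq0 sz.
have := max_poly_roots nz s_roots s_uniq.
by rewrite sz [size s]/= size_map -cardE card_Fp // ltnn.
Qed.

Section Code.

Variables (p m l : nat) (F : finFieldType).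

(* The coefficients a ranges over: all of F, or the subfield of p^(m/2) elements
   of F when l = m/2, an equation that fails when m is odd. *)
Definition quad_coef : {set F} :=
  if (l.*2 == m)%N then [set a : F | a ^+ (p ^ m./2) == a] else [set: F].

Definition codeword (a b : F) (h : 'F_p) : {ffun F -> 'F_p} :=
  [ffun x => abs_trace p m (a * x ^+ (p ^ l).+1 + b * x) + h].

Definition code : {set {ffun F -> 'F_p}} :=
  [set c | [exists a in quad_coef, exists b, exists h, c == codeword a b h]].

Definition supp (c : {ffun F -> 'F_p}) : {set F} := [set x | c x != 0].

Definition hweight (c : {ffun F -> 'F_p}) : nat := #|supp c|.

Definition blocks (i : nat) : {set {set F}} :=
  [set supp c | c in code & hweight c == i].

End Code.

Definition is_2design (T : finType) (B : {set {set T}}) (v k lambda : nat) : Prop :=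
  [/\ #|T| = v,
      forall b : {set T}, b \in B -> #|b| = k
    & forall S : {set T}, #|S| = 2%N -> #|[set b in B | S \subset b]| = lambda].

(* The pair (i, lambda) is given by rational expressions, with signs and
   quotients; the existentials include that both values are natural numbers. *)
Definition holds_2design (p m l : nat) (F : finFieldType) (i lambda : rat) : Prop :=
  exists k n : nat,
    [/\ k%:R = i, n%:R = lambda & is_2design (blocks p m l F k) (p ^ m) k n].

(* Main.v *)
(* Substitutions x -> u x + v preserve the code, so the supports of the words of
   weight i always form a 2-design, and lambda (q (q - 1)) = |B_i| i (i - 1); only
   |B_i| has to be found.  Words with the same support are proportional, because
   otherwise some combination would weigh less than the minimum weight, so
   |B_i| (p - 1) is the number of words of weight i.

   The weight distribution is computed without characters.  Let Q_a be the form
   Tr (a x^(p^l+1)), with radical of size r.  If Tr (b x) vanishes on the radical,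
   the word (a, b, h) is a translate of Q_a plus a constant; otherwise it is
   balanced.  Counting pairs (x, y) with Q_a x = Q_a y gives the second moment of
   the level sizes of Q_a in terms of r, and counting pairs (a, x) with Q_a x = 0
   gives their mean over a.  For m even, scalars are (p^l+1)-th powers, so Q_a
   takes all nonzero values equally often and S = |Q_a = 0| - |Q_a = 1| satisfies
   S^2 = q r.  The sign of S is balanced over a when m/d is odd, and forced by
   S = 1 mod (p^d + 1) when m/d is even: the fibres of x -> x^(p^l+1) on nonzero
   elements then have size p^d + 1.  For m odd, every nonzero a is a scalar times a
   (p^l+1)-th power, so |Q_a = 0| does not depend on a, and the second moment
   determines the two remaining level sizes. *)

Require Import Defs.
From HB Require Import structures.
From mathcomp Require Import all_boot all_order all_algebra all_fingroup all_field.
From mathcomp Require Import cyclic.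
From mathcomp Require Import ring zify.
Set Implicit Arguments.
Unset Strict Implicit.
Unset Printing Implicit Defensive.
Import Order.TTheory GRing.Theory Num.Theory.
Local Open Scope ring_scope.

(** * Frobenius powers, the prime field and the trace *)

Section FiniteField.

Variables (p m : nat) (F : finFieldType).
Hypotheses (p_pr : prime p) (cardF : #|F| = (p ^ m)%N).

Local Notation q := (p ^ m)%N.
Local Notation tr := (@abs_trace p m F).

Let chF : p \in [pchar F] := card_finPcharP cardF p_pr.
Let p_gt0 : (0 < p)%N := prime_gt0 p_pr.
Let p_gt1 : (1 < p)%N := prime_gt1 p_pr.

Lemma frobD i (x y : F) : (x + y) ^+ (p ^ i) = x ^+ (p ^ i) + y ^+ (p ^ i).
Proof. by apply: exprDn_pchar; rewrite pnatX pnatE // chF. Qed.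

Lemma frobN i (x : F) : (- x) ^+ (p ^ i) = - x ^+ (p ^ i).
Proof.
by apply: (addrI (x ^+ (p ^ i))); rewrite -frobD !subrr expr0n expn_eq0 gtn_eqF.
Qed.

Lemma frob0 i : 0 ^+ (p ^ i) = 0 :> F.
Proof. by rewrite expr0n expn_eq0 gtn_eqF. Qed.

Lemma frob_nat i k : k%:R ^+ (p ^ i) = k%:R :> F.
Proof.
elim: i => [|i IH]; first by rewrite expr1.
by rewrite expnSr exprM IH -(pFrobenius_autE chF) pFrobenius_aut_nat.
Qed.

Lemma frob_inj i : injective (fun x : F => x ^+ (p ^ i)).
Proof.
move=> x y /= /eqP; rewrite -subr_eq0 -frobN -frobD expf_eq0 => /andP[_].
by rewrite subr_eq0 => /eqP.
Qed.

Lemma frob_card (x : F) : x ^+ q = x.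
Proof. by rewrite -cardF expf_card. Qed.

(** The trace has values in the type ['F_p], while its defining sum lives in [F]. Trace identities
    are proved after applying this injective ring morphism. *)
Definition emb (u : 'F_p) : F := (u : nat)%:R.

Lemma embD u v : emb (u + v) = emb u + emb v.
Proof.
rewrite /emb -natrD -[RHS](GRing.natr_mod_pchar chF) /=; congr (_ %:R).
(* The modulus built into ['F_p] is a term that reduces to [p] only by primality. *)
by congr (_ %% _)%N; apply: Fp_cast.
Qed.

Lemma embM u v : emb (u * v) = emb u * emb v.
Proof.
rewrite /emb -natrM -[RHS](GRing.natr_mod_pchar chF) /=; congr (_ %:R).
by congr (_ %% _)%N; apply: Fp_cast.
Qed.

Lemma emb0 : emb 0 = 0. Proof. by []. Qed.

Lemma embN u : emb (- u) = - emb u.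
Proof. by apply: (addrI (emb u)); rewrite -embD !subrr. Qed.

Lemma emb_eq0 u : (emb u == 0) = (u == 0).
Proof.
apply/idP/eqP => [|-> //]; rewrite -(dvdn_pcharf chF) => p_u.
apply/val_inj/eqP; rewrite /= -leqn0 leqNgt; apply/negP => /dvdn_leq/(_ p_u).
by apply/negP; rewrite -ltnNge -[X in (_ < X)%N](Fp_cast p_pr) ltn_ord.
Qed.

Lemma emb_inj : injective emb.
Proof.
move=> u v /eqP; rewrite -subr_eq0 -embN -embD emb_eq0 subr_eq0.
by move/eqP.
Qed.

Lemma emb_frob i u : emb u ^+ (p ^ i) = emb u.
Proof. exact: frob_nat. Qed.

Lemma trE x : emb (tr x) = \sum_(i < m) x ^+ (p ^ i).
Proof. exact: abs_traceE. Qed.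

Lemma trD x y : tr (x + y) = tr x + tr y.
Proof.
apply: emb_inj; rewrite embD !trE -big_split /=.
by apply: eq_bigr => i _; rewrite frobD.
Qed.

Lemma tr_scale u x : tr (emb u * x) = u * tr x.
Proof.
apply: emb_inj; rewrite embM !trE mulr_sumr.
by apply: eq_bigr => i _; rewrite exprMn emb_frob.
Qed.

Lemma tr0 : tr 0 = 0.
Proof. by apply: (addrI (tr 0)); rewrite -trD !addr0. Qed.

Lemma trN x : tr (- x) = - tr x.
Proof. by apply: (addrI (tr x)); rewrite -trD !subrr tr0. Qed.

(** One Frobenius step shifts the terms of the trace sum cyclically, because [y ^+ q = y]; adding
    [y] on both sides gives the same sum of [m.+1] terms. *)
Lemma tr_frob i x : tr (x ^+ (p ^ i)) = tr x.
Proof.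
elim: i => [|i IH]; first by rewrite expr1.
rewrite expnSr exprM -{}[RHS]IH; move: (x ^+ _) => y; apply: emb_inj.
rewrite !trE; apply: (@addrI _ y).
have -> : y + \sum_(j < m) (y ^+ p) ^+ (p ^ j) = \sum_(j < m.+1) y ^+ (p ^ j).
  rewrite big_ord_recl expr1; congr (_ + _); apply: eq_bigr => j _.
  by rewrite -exprM -expnS.
by rewrite big_ord_recr /= frob_card addrC.
Qed.

(** The trace is a polynomial function of degree [p ^ m.-1], too small to vanish at all [q]
    elements. *)
Lemma tr_nontrivial : exists x, tr x != 0.
Proof.
have [m0|m_gt0] := posnP m.
  by move: (card_finRing_gt1 F); rewrite cardF m0.
apply/existsP; rewrite -negb_forall; apply/negP => /forallP tr_all0.
pose P : {poly F} := \sum_(i < m) 'X^(p ^ i).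
have szP : size P = (p ^ m.-1).+1.
  rewrite /P -(prednK m_gt0) big_ord_recr /= addrC size_polyDl size_polyXn //.
  apply: leq_ltn_trans (size_sum _ _ _) _; apply/bigmax_leqP => i _.
  by rewrite size_polyXn ltn_exp2l.
have nzP : P != 0 by rewrite -size_poly_eq0 szP.
have rts : all (root P) (enum F).
  apply/allP => x _; rewrite rootE horner_sum.
  under eq_bigr do rewrite hornerXn.
  by rewrite -trE (eqP (tr_all0 x)).
have := max_poly_roots nzP rts (enum_uniq F).
by rewrite szP -cardE cardF ltnS leq_exp2l // leqNgt prednK // leqnn.
Qed.

(** * Fibres and roots in the finite field *)

Lemma card_Fp_nz : #|[set u : 'F_p | u != 0]| = p.-1.
Proof.
have -> : [set u : 'F_p | u != 0] = ~: [set 0] by apply/setP => u; rewrite !inE.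
have := cardsC [set (0 : 'F_p)]; rewrite cards1 card_Fp // => e.
by rewrite -subn1; apply: (canRL (addKn 1) e).
Qed.

(* Translation by z permutes the fibres of f on K cyclically, so they all have
   the same size. *)
Lemma shift_fibres (K : {set F}) (f : F -> 'F_p) (z : F) (c t : 'F_p) :
  c != 0 -> (forall x, x \in K -> x + z \in K) ->
  (forall x, x \in K -> f (x + z) = f x + c) ->
  (#|[set x in K | f x == t]| * p)%N = #|K|.
Proof.
move=> c_nz Kz fz; pose fib s := [set x in K | f x == s].
have le1 s : (#|fib s| <= #|fib (s + c)%R|)%N.
  rewrite -(card_imset (fib s) (addIr z)); apply/subset_leq_card/subsetP => y.
  case/imsetP => x; rewrite inE => /andP[Kx /eqP fx] ->.
  by rewrite inE Kz //= fz // fx.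
have lek s k : (#|fib s| <= #|fib (s + c *+ k)%R|)%N.
  elim: k => [|k IH]; first by rewrite addr0.
  by apply: leq_trans IH _; rewrite mulrSr addrA; apply: le1.
have le s s' : (#|fib s| <= #|fib s'|)%N.
  (* Since [c] is nonzero it generates ['F_p] additively; the number of steps from [s] to [s'] is
     the representative of [(s' - s) / c]. *)
  have -> : s' = s + c *+ ((s' - s) / c : 'F_p).
    by rewrite -mulr_natr natr_Zp mulrC divfK // addrC subrK.
  exact: lek.
rewrite -[RHS]sum1_card (partition_big f predT) //=.
rewrite (eq_bigr (fun=> #|fib t|)) => [|s _].
  by rewrite sum_nat_const card_Fp // mulnC.
rewrite sum1dep_card; apply: anti_leq.
have -> : [set x | (x \in K) && (f x == s)] = fib s by [].
by rewrite !le.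
Qed.

(** Translation by [w / c], where [tr w != 0], shifts [tr (c * x)] by a nonzero constant. *)
Lemma tr_fibre (c : F) (t : 'F_p) : c != 0 ->
  (#|[set x | tr (c * x)%R == t]| * p)%N = q.
Proof.
move=> c_nz; have [w w_nz] := tr_nontrivial.
have shift x : x \in setT -> tr (c * (x + w / c)) = tr (c * x) + tr w.
  by move=> _; rewrite mulrDr trD [c * (w / c)]mulrC divfK.
have := shift_fibres t w_nz (fun x _ => in_setT _) shift.
rewrite cardsT cardF => <-; congr (#|pred_of_set _| * _)%N.
by apply/setP => x; rewrite !inE.
Qed.

Lemma expf_pred (x : F) : x != 0 -> x ^+ q.-1 = 1.
Proof.
move=> x_nz; apply: (mulIf x_nz).
by rewrite mul1r -exprSr prednK ?expn_gt0 ?p_gt0 ?frob_card.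
Qed.

Lemma pred_q_gt0 : (0 < q.-1)%N.
Proof. by have := card_finRing_gt1 F; rewrite cardF; case: (q) => [|[]]. Qed.

Lemma ex_primitive : exists g : F, q.-1.-primitive_root g.
Proof.
pose rs := enum [set x : F | x != 0].
have /hasP[g _ pg] : has (q.-1).-primitive_root rs.
  apply: has_prim_root; rewrite ?pred_q_gt0 ?enum_uniq //.
    apply/allP => x; rewrite mem_enum inE unity_rootE => x_nz.
    by rewrite expf_pred.
  rewrite -cardE; have -> : [set x : F | x != 0] = ~: [set 0].
    by apply/setP => x; rewrite !inE.
  by have := cardsC [set (0 : F)]; rewrite cards1 cardF => <-.
by exists g.
Qed.

Lemma card_unity_roots n : (n %| q.-1)%N -> #|[set x : F | x ^+ n == 1]| = n.
Proof.
move=> n_dv; have [g pg] := ex_primitive.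
have pz := dvdn_prim_root pg n_dv; set z := g ^+ _ in pz.
have -> : [set x : F | x ^+ n == 1] = [set z ^+ i | i : 'I_n].
  apply/setP => x; rewrite inE; apply/eqP/imsetP => [xn|[i _ ->]].
    by have [i ->] := prim_rootP pz xn; exists i.
  by rewrite -exprM mulnC exprM (prim_expr_order pz) expr1n.
rewrite card_imset ?card_ord // => i j /eqP.
by rewrite (eq_prim_root_expr pz) !modn_small ?ltn_ord // => /eqP/val_inj.
Qed.

Lemma expf_eq1_gcd n (x : F) :
  x != 0 -> (x ^+ n == 1) = (x ^+ gcdn n q.-1 == 1).
Proof.
move=> x_nz; have [->|n_gt0] := posnP n.
  by rewrite gcd0n expr0 expf_pred.
apply/eqP/eqP => [xn|xg]; last first.
  by rewrite -(divnK (dvdn_gcdl n q.-1)) mulnC exprM xg expr1n.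
have [u v e _] := egcdnP q.-1 n_gt0.
have: x ^+ (u * n) = x ^+ (v * q.-1 + gcdn n q.-1) by rewrite e.
by rewrite mulnC exprM xn expr1n exprD mulnC exprM expf_pred // expr1n mul1r.
Qed.

(** A nonempty fibre of the power map is a coset of the group of roots of unity of order
    [gcdn n q.-1]. *)
Lemma power_fibre_dvd n (y : F) :
  (0 < n)%N -> y != 0 -> (gcdn n q.-1 %| #|[set x : F | x ^+ n == y]|)%N.
Proof.
move=> n_gt0 y_nz; set A := [set x | _].
have [->|[x0]] := set_0Vmem A; first by rewrite cards0.
rewrite inE => /eqP x0y.
have x0_nz : x0 != 0.
  by apply: contraNneq y_nz => x0_0; rewrite -x0y x0_0 expr0n gtn_eqF.
rewrite -[X in (X %| _)%N](card_unity_roots (dvdn_gcdr n _)).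
have -> : A = [set x0 * w | w in [set x : F | x ^+ gcdn n q.-1 == 1]].
  apply/setP => x; rewrite inE; apply/eqP/imsetP => [xy|[w]].
    have x_nz : x != 0.
      by apply: contraNneq y_nz => x_0; rewrite -xy x_0 expr0n gtn_eqF.
    exists (x / x0); last by rewrite mulrC divfK.
    rewrite inE -expf_eq1_gcd ?mulf_neq0 ?invr_eq0 //.
    by rewrite exprMn exprVn xy x0y divff.
  rewrite inE => w1 ->.
  have w_nz : w != 0.
    apply: contraTneq w1 => ->; rewrite expr0n gtn_eqF ?gcdn_gt0 ?n_gt0 //.
    by rewrite eq_sym oner_eq0.
  by rewrite exprMn x0y; rewrite -expf_eq1_gcd // in w1; rewrite (eqP w1) mulr1.
by rewrite card_imset //; apply: mulfI.
Qed.

(** Write [x] as a power [g ^+ i] of a primitive root: the hypothesis says that the gcd divides [i],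
    and Bezout then produces the root. *)
Lemma ex_nth_root n (x : F) :
  (0 < n)%N -> x != 0 -> x ^+ (q.-1 %/ gcdn n q.-1) = 1 ->
  exists2 y : F, y != 0 & y ^+ n = x.
Proof.
move=> n_gt0 x_nz x1; have [g pg] := ex_primitive.
have [i ex] := prim_rootP pg (expf_pred x_nz).
have dv : (gcdn n q.-1 %| i)%N.
  move: x1; rewrite ex -exprM => /eqP; rewrite -(prim_order_dvd pg).
  rewrite -[X in (X %| _)%N -> _](divnK (dvdn_gcdr n q.-1)) mulnC dvdn_pmul2r //.
  by rewrite divn_gt0 ?gcdn_gt0 ?n_gt0 // dvdn_leq ?pred_q_gt0 ?dvdn_gcdr.
have g_nz : g != 0.
  apply/eqP => g0; have := prim_expr_order pg.
  by rewrite g0 expr0n gtn_eqF ?pred_q_gt0 // => /esym/eqP; rewrite oner_eq0.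
have [u v e _] := egcdnP q.-1 n_gt0.
(* The exponent works because [u * n] is the gcd modulo [q.-1]. *)
exists (g ^+ (u * (i %/ gcdn n q.-1))); first by rewrite expf_neq0.
rewrite -exprM mulnAC e mulnDl exprD mulnAC mulnC exprM.
by rewrite (prim_expr_order pg) expr1n mul1r mulnC divnK.
Qed.

(** * The quadratic forms and their level sets *)

Variable l : nat.
Hypotheses (p_odd : odd p) (l_lt : (l < m)%N).

Local Notation n := (p ^ l).+1.

Definition qform (a x : F) : 'F_p := tr (a * x ^+ n).

(** The linear map that represents the polar form of [qform a] through the trace pairing, as
    [qformD] shows. *)
Definition polar (a y : F) : F := a * y ^+ (p ^ l) + (a * y) ^+ (p ^ (m - l)).

Definition radical (a : F) : {set F} := [set y | polar a y == 0].

Definition level (a : F) (t : 'F_p) : nat := #|[set x | qform a x == t]|.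

Arguments level (a t)%_R.

Lemma qformD a x y :
  qform a (x + y) = qform a x + qform a y + tr (polar a y * x).
Proof.
(* A Frobenius power of index [m - l] inside the trace turns [w ^+ (p ^ l)] into [w ^+ q = w]. *)
have e z w : tr (z * w ^+ (p ^ l)) = tr (z ^+ (p ^ (m - l)) * w).
  rewrite -(tr_frob (m - l)) exprMn -exprM -expnD subnKC ?frob_card //.
  exact: ltnW.
have -> : tr (polar a y * x) = tr (a * y ^+ (p ^ l) * x) + tr (a * y * x ^+ (p ^ l)).
  by rewrite /polar mulrDl trD [in RHS]e.
rewrite /qform !exprS frobD.
by rewrite -!trD; congr tr; ring.
Qed.

Lemma polarD a y z : polar a (y + z) = polar a y + polar a z.
Proof. by rewrite /polar frobD !mulrDr frobD; ring. Qed.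

Lemma polar0 a : polar a 0 = 0.
Proof. by apply: (addrI (polar a 0)); rewrite -polarD !addr0. Qed.

Lemma polarN a y : polar a (- y) = - polar a y.
Proof. by apply: (addrI (polar a y)); rewrite -polarD !subrr polar0. Qed.

Lemma polar_sym a x y : tr (polar a y * x) = tr (polar a x * y).
Proof.
have := qformD a x y; rewrite addrC qformD [qform a y + _]addrC.
by move/addrI.
Qed.

(** Raising to the power [p ^ l], which is injective, turns the second term of [polar] back into
    [a * y]. *)
Lemma polar_eq0 a y :
  (polar a y == 0) = (a ^+ (p ^ l) * y ^+ (p ^ (2 * l)) == - (a * y)).
Proof.
rewrite -(inj_eq (@frob_inj l)) /= frob0 /polar frobD exprMn -!exprM -!expnD.
by rewrite subnK ?(ltnW l_lt) // addnn -mul2n frob_card addr_eq0.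
Qed.

Lemma two_nz : 2%:R != 0 :> F.
Proof.
rewrite -(dvdn_pcharf chF); apply/negP => /(@dvdn_leq p 2 isT).
by move: p_gt1 p_odd; case: (p) => [|[|[|]]].
Qed.

Lemma Fp_double_eq0 (t : 'F_p) : t + t = 0 -> t = 0.
Proof.
move/(congr1 emb); rewrite embD -mulr2n -mulr_natr emb0 => /eqP.
by rewrite mulf_eq0 (negPf two_nz) orbF emb_eq0 => /eqP.
Qed.

Lemma qform0 a : qform a 0 = 0.
Proof. by rewrite /qform expr0n /= mulr0 tr0. Qed.

Lemma qformN a x : qform a (- x) = qform a x.
Proof. by rewrite /qform exprNn -signr_odd /= oddX p_odd orbT mul1r. Qed.

(** Expanding [qform a (- y + y) = 0] leaves twice [qform a y], and [p] is odd. *)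
Lemma qform_radical a y : y \in radical a -> qform a y = 0.
Proof.
rewrite inE => /eqP ky; apply: Fp_double_eq0.
have := qformD a (- y) y; rewrite addNr qform0 qformN ky mul0r tr0 addr0.
by move=> <-.
Qed.

Lemma qform_scale a v x : qform (a * v ^+ n) x = qform a (v * x).
Proof. by rewrite /qform exprMn mulrA. Qed.

Lemma level_scale a v t : v != 0 -> level (a * v ^+ n) t = level a t.
Proof.
move=> v_nz; rewrite /level -(card_imset _ (mulfI v_nz)).
congr #|pred_of_set _|; apply/setP => y; rewrite inE.
apply/imsetP/idP => [[x]|Qy]; first by rewrite inE qform_scale => Qx ->.
exists (y / v); last by rewrite mulrC divfK.
by rewrite inE qform_scale mulrC divfK.
Qed.

Lemma level_emb a u t : u != 0 -> level (emb u * a) (u * t) = level a t.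
Proof.
move=> u_nz; congr #|pred_of_set _|; apply/setP => x; rewrite !inE.
by rewrite /qform -mulrA tr_scale (inj_eq (mulfI u_nz)).
Qed.

Lemma sum_level a : (\sum_t level a t)%N = q.
Proof.
rewrite -cardF -cardsT -[RHS]sum1_card (partition_big (qform a) predT) //=.
apply: eq_bigr => t _; rewrite sum1dep_card; congr #|pred_of_set _|.
by apply/setP => x; rewrite !inE.
Qed.

(** The sum of squares counts pairs [(x, x + z)] on which [qform a] agrees. Every [x] qualifies if
    [z] is in the radical, and exactly [q / p] of them otherwise. The form of the identity avoids
    division and subtraction. *)
Lemma sum_level_sqr a :
  ((\sum_t level a t ^ 2) * p + #|radical a| * q = #|radical a| * (q * p) + q * q)%N.
Proof.
pose N x z : nat := qform a (x + z) == qform a x.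
have -> : (\sum_t level a t ^ 2 = \sum_(x : F) \sum_(z : F) N x z)%N.
  rewrite [RHS](partition_big (qform a) predT) //=; apply: eq_bigr => t _.
  rewrite (eq_bigr (fun=> level a t)) => [|x /eqP Qx].
    rewrite sum_nat_const expnS expn1; congr (_ * _)%N.
    by apply: eq_card => x; rewrite !inE.
  rewrite -big_mkcond sum1dep_card /level /=.
  rewrite -(card_imset [set z | _] (addrI x)); congr #|pred_of_set _|.
  apply/setP => y; rewrite inE -Qx; apply/imsetP/idP => [[z]|Qy].
    by rewrite inE => Qz ->.
  by exists (y - x); rewrite ?inE addrC subrK.
rewrite exchange_big /= (bigID (mem (radical a))) /= mulnDl.
rewrite (eq_bigr (fun=> q)) => [|z kz].
  rewrite sum_nat_const.
  rewrite big_distrl /= (eq_bigr (fun=> q)) => [|z kz].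
    rewrite sum_nat_const.
    have: (#|radical a| + #|(fun i : F => i \notin radical a)| = q)%N.
      by rewrite -cardF -(cardC (mem (radical a))).
    by move: #|radical a| #|_| q => r k Q <-; ring.
  rewrite -big_mkcond sum1dep_card -(@tr_fibre (polar a z) (- qform a z)) ?inE //.
    congr (#|pred_of_set _| * _)%N; apply/setP => x; rewrite !inE.
    rewrite /N qformD -addrA -[in RHS]addr_eq0 [in RHS]addrC.
    by rewrite -[X in _ == X]addr0 (inj_eq (addrI _)).
  by move: kz; rewrite inE.
have /eqP pz : polar a z == 0 by rewrite inE in kz.
rewrite -cardF -sum1_card; apply: eq_bigr => x _.
by rewrite /N qformD (qform_radical kz) pz mul0r tr0 !addr0 eqxx.
Qed.

(** Count pairs [(a, x)] with [qform a x = 0] by [x]: all [a] qualify for [x = 0], and [q / p] of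
    them otherwise, as the trace is linear in [a]. *)
Lemma sum_level0 : ((\sum_a level a 0%R) * p = q * p + q.-1 * q)%N.
Proof.
pose N x a : nat := qform a x == 0.
have -> : (\sum_a level a 0%R = \sum_(x : F) \sum_(a : F) N x a)%N.
  rewrite exchange_big; apply: eq_bigr => a _.
  by rewrite -big_mkcond sum1dep_card.
rewrite (bigD1 0) //= mulnDl; congr (_ * _ + _)%N.
  by rewrite -cardF -sum1_card; apply: eq_bigr => a _; rewrite /N qform0 eqxx.
rewrite big_distrl /= (eq_bigr (fun=> q)) => [|x x_nz].
  by rewrite sum_nat_const (cardC1 (0 : F)) cardF.
rewrite -(@tr_fibre (x ^+ n) 0) ?expf_neq0 // -big_mkcond sum1dep_card.
by congr (#|pred_of_set _| * _)%N; apply/setP => a; rewrite !inE /qform mulrC.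
Qed.

(** The nonzero elements of a level set split into full fibres of [x ^+ n], each of size divisible
    by the gcd. The subtracted term removes [x = 0]. *)
Lemma level_dvd a t : (gcdn n q.-1 %| level a t - (t == 0%R))%N.
Proof.
have -> : (level a t - (t == 0%R) = #|[set x | (x != 0%R) && (qform a x == t)]|)%N.
  rewrite /level [X in (X - _)%N](cardsD1 0) inE qform0 [0 == t]eq_sym addKn;
    congr #|pred_of_set _|.
  by apply/setP => x; rewrite !inE.
rewrite -sum1_card (partition_big (fun x => x ^+ n) predT) //=.
apply: dvdn_sum => y _.
have [x /= /andP[]|no_x] := pickP [pred x | (x \in [set x
  | (x != 0%R) && (qform a x == t)]) && (x ^+ n == y)]; last first.
  by rewrite big_pred0 ?dvdn0 // => x; have := no_x x.
rewrite inE => /andP[x_nz Qx] xy.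
have y_nz : y != 0 by rewrite -(eqP xy) expf_neq0.
rewrite sum1dep_card;
  have -> : [set z | (z \in [set x
  | (x != 0%R) && (qform a x == t)]) && (z ^+ n == y)] = [set z | z ^+ n == y].
  apply/setP => z; rewrite !inE andbC; case: eqP => //= zy.
  have -> : qform a z = qform a x by rewrite /qform zy (eqP xy).
  by rewrite Qx andbT; apply: contraNneq y_nz => z0; rewrite -zy z0 expr0n.
exact: power_fibre_dvd.
Qed.

(** Every fibre of the additive map [polar a] over its image is a translate of the radical. *)
Lemma card_polar_im a : (#|polar a @: setT| * #|radical a| = q)%N.
Proof.
rewrite -cardF -cardsT -[RHS]sum1_card (partition_big_imset (polar a)) /=.

rewrite (eq_bigr (fun=> #|radical a|)) => [|b bP].
  by rewrite sum_nat_const.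
have [v _ ->] := imsetP bP.
rewrite sum1dep_card -(card_imset (radical a) (addrI v)); congr #|pred_of_set _|.
apply/setP => y; rewrite !inE /=; apply/idP/imsetP => [/eqP yv|[z]].
  by exists (y - v); rewrite ?inE 1?addrC ?subrK // addrC polarD polarN yv subrr.
by rewrite inE => /eqP z0 ->; rewrite polarD z0 addr0.
Qed.

Definition orth (a : F) : {set F} :=
  [set b | [forall z in radical a, tr (b * z) == 0]].

Lemma radical_add a y z : y \in radical a -> z \in radical a -> y + z \in radical a.
Proof. by rewrite !inE polarD => /eqP -> /eqP ->; rewrite addr0. Qed.

(** Double count of the pairs [(b, z)] with [z] in the radical and [tr (b * z) = 0]. By [z]: [q]
    pairs for [z = 0], else [q / p]. By [b]: the whole radical for [b] in [orth a], else a fraction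
    [1 / p] of it. *)
Lemma card_orth a : (#|orth a| * #|radical a| = q)%N.
Proof.
pose N b z : nat := tr (b * z) == 0.
have count : (\sum_(b : F) \sum_(z in radical a) N b z * p =
  q * p + #|radical a|.-1 * q)%N.
  rewrite exchange_big /= (bigD1 0) /=; last by rewrite inE polar0.
  rewrite -big_distrl /=; congr (_ * _ + _)%N.
    by rewrite -cardF -sum1_card; apply: eq_bigr => b _; rewrite /N mulr0 tr0 eqxx.
  rewrite (eq_bigr (fun=> q)) => [|z /andP[_ z_nz]].
    rewrite sum_nat_const; congr (_ * _)%N.
    rewrite (cardsD1 0 (radical a)) inE polar0 eqxx /=; apply: eq_card => z.
    by rewrite [LHS]andbC !inE.
  rewrite -(@tr_fibre z 0) //.
  transitivity ((\sum_(b : F) N b z) * p)%N; first by rewrite big_distrl.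
  rewrite -big_mkcond sum1dep_card.
  by congr (#|pred_of_set _| * _)%N; apply/setP => b; rewrite !inE mulrC.
have: (\sum_(b : F) \sum_(z in radical a) N b z * p =
  #|orth a| * (#|radical a| * p) + (q - #|orth a|) * #|radical a|)%N.
  rewrite (bigID (mem (orth a))) /=; congr (_ + _)%N.
    rewrite -sum_nat_const; apply: eq_bigr => b; rewrite inE => /forall_inP ob.
    rewrite -big_distrl /=; congr (_ * _)%N; rewrite -sum1_card; apply: eq_bigr => z kz.
    by rewrite /N ob.
  rewrite -cardF -(cardC (mem (orth a))) addKn -sum_nat_const.
  apply: eq_bigr => b; rewrite inE negb_forall_in => /exists_inP[z kz bz].
  have shift x : x \in radical a -> tr (b * (x + z)) = tr (b * x) + tr (b * z).
    by move=> _; rewrite mulrDr trD.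
  rewrite -(shift_fibres 0 bz (fun x kx => radical_add kx kz) shift).
  transitivity ((\sum_(x in radical a) N b x) * p)%N; first by rewrite big_distrl.
  by rewrite -big_mkcondr sum1dep_card.
rewrite count; have r_gt0 : (0 < #|radical a|)%N.
  by apply/card_gt0P; exists 0; rewrite inE polar0.
have le_o : (#|orth a| <= q)%N by rewrite -cardF max_card.
have p1 := p_gt1; move: le_o r_gt0; move: #|orth a| #|radical a| q => o r Q le_o.
case: r => // r _ e /=; rewrite /= in e.
(* Equating the two counts leaves the claim multiplied by [p.-1]. *)
have {}e : (Q * p.-1 = o * r.+1 * p.-1)%N.
  move: e; rewrite mulnBl -(prednK p_gt0) /=; have := leq_mul le_o (leqnn r.+1).
  move: p.-1 => s; nia.
by apply/eqP; rewrite -(@eqn_pmul2r p.-1) ?e ?eqxx // -ltnS prednK.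
Qed.

(** Symmetry of the polar form gives one inclusion, and the cardinalities agree. Hence a linear term
    that is trivial on the radical can be absorbed by completing the square. *)
Lemma orthE a : orth a = polar a @: setT.
Proof.
apply/esym/eqP; rewrite eqEcard; apply/andP; split.
  apply/subsetP => _ /imsetP[v _ ->]; rewrite inE; apply/forall_inP => z.
  by rewrite inE polar_sym => /eqP ->; rewrite mul0r tr0.
have r_gt0 : (0 < #|radical a|)%N.
  by apply/card_gt0P; exists 0; rewrite inE polar0.
by rewrite -(leq_pmul2r r_gt0) card_orth card_polar_im.
Qed.

(** * Weights of codewords *)

Local Notation cw := (@codeword p m l F).
Local Notation coef := (@quad_coef p m l F).
Local Notation blk := (@blocks p m l F).

Lemma cwE a b h x : cw a b h x = qform a x + tr (b * x) + h.
Proof. by rewrite ffunE trD. Qed.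

Lemma hweight_zeros (c : {ffun F -> 'F_p}) :
  (hweight c + #|[set x | c x == 0%R]| = q)%N.
Proof.
rewrite -cardF -(cardsC (supp c)); congr (_ + #|pred_of_set _|)%N.
by apply/setP => x; rewrite !inE negbK.
Qed.

(** Completing the square: the word at [x] is [qform a (x + v) - (qform a v - h)], so its zeros form
    a translate of a level set. *)
Lemma hweight_polar a v h :
  (hweight (cw a (polar a v) h) + level a (qform a v - h)%R = q)%N.
Proof.
rewrite -(hweight_zeros (cw a (polar a v) h)); congr (_ + _)%N.
rewrite /level -(card_imset [set x | cw a (polar a v) h x == 0] (addIr v));
  congr #|pred_of_set _|.
have e x : (cw a (polar a v) h x == 0) = (qform a (x + v) == qform a v - h).
  by rewrite cwE qformD -subr_eq0 -[in RHS]subr_eq0; congr (_ == 0); ring.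
apply/setP => y; rewrite inE; apply/idP/imsetP => [Qy|[x]].
  by exists (y - v); rewrite ?inE ?e subrK.
by rewrite inE e => Qx ->.
Qed.

(** Translation by a radical element on which [tr (b * z)] is nonzero shifts the word by a nonzero
    constant, so all values occur equally often. *)
Lemma hweight_balanced a b h :
  b \notin orth a -> (hweight (cw a b h) * p + q = q * p)%N.
Proof.
rewrite inE negb_forall_in => /exists_inP[z kz bz].
have shift x : x \in setT -> cw a b h (x + z) = cw a b h x + tr (b * z).
  move=> _; rewrite !cwE qformD mulrDr trD (qform_radical kz).
  by move: kz; rewrite inE => /eqP ->; rewrite mul0r tr0; ring.
have := shift_fibres 0 bz (fun x _ => in_setT _) shift; rewrite cardsT cardF => e.
rewrite -[in RHS](hweight_zeros (cw a b h)) mulnDl; congr (_ + _)%N.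
rewrite -e; congr (#|pred_of_set _| * _)%N.
by apply/setP => x; rewrite !inE.
Qed.

Definition wcount a k : nat :=
  #|[set bh : F * 'F_p | hweight (cw a bh.1 bh.2) == k]|.

Lemma radical_gt0 a : (0 < #|radical a|)%N.
Proof. by apply/card_gt0P; exists 0; rewrite inE polar0. Qed.

(** For each [b = polar a v], the substitution [t = qform a v - h] turns the count over [h] into one
    over levels. For every other [b] the weight is the balanced one, whatever [h]. *)
Lemma wcountE a k :
  (#|radical a| * wcount a k =
   q * #|[set t | k + level a t == q]|
   + #|radical a|.-1 * (q * p * (k * p + q == q * p)))%N.
Proof.
have -> : (wcount a k = \sum_(b : F) \sum_(h : 'F_p) (hweight (cw a b h) == k))%N.
  by rewrite pair_big -big_mkcond sum1dep_card.
rewrite (bigID (mem (orth a))) /=.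
rewrite (eq_bigr (fun=> #|[set t | (k + level a t == q)%N]|)) => [|b]; last first.
  rewrite orthE => /imsetP[v _ ->].
  rewrite -big_mkcond sum1dep_card -[RHS](card_imset _ (subrI (qform a v))).
  congr #|pred_of_set _|; apply/setP => h; rewrite inE.
  have e := hweight_polar a v h.
  apply/eqP/imsetP => [<-|[t]].
    by exists (qform a v - h); rewrite ?subKr // inE e.
  rewrite inE => kt eh; rewrite eh subKr in e.
  by apply/eqP; rewrite eh -(eqn_add2r (level a t)) e eq_sym.
rewrite sum_nat_const.
rewrite (eq_bigr (fun=> p * (k * p + q == q * p)))%N => [|b bo]; last first.
  rewrite (eq_bigr (fun=> nat_of_bool (k * p + q == q * p)%N)) => [|h _].
    by rewrite sum_nat_const card_Fp.
  by rewrite -(hweight_balanced h bo) eqn_add2r eqn_pmul2r // eq_sym.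
have co := card_orth a; have r_gt0 := radical_gt0 a.
have: (#|orth a| + #|(fun b : F => b \notin orth a)| = q)%N.
  by rewrite -cardF -(cardC (mem (orth a))).
rewrite sum_nat_const; move: (k * p + q == q * p)%N => e.
move: #|(fun b : F => b \notin orth a)| #|orth a| co #|[set t | _]| => o' o co T.
move: co; case: #|radical a| r_gt0 => // r _; move: q => Q co oQ /=.
have -> : (r * (Q * p * e) = r.+1 * (o' * (p * e)))%N; last by rewrite -co; ring.
have rQ : (r * Q = r.+1 * o')%N by nia.
by rewrite !mulnA rQ.
Qed.

(** On the common support the ratio [c1 x / c2 x] takes at most [p.-1] values, so some [u] is taken
    on at least that fraction of it, where [c1 - u * c2] vanishes. *)
Lemma same_supp (c1 c2 : {ffun F -> 'F_p}) :
  supp c1 = supp c2 ->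
  exists2 u : 'F_p, u != 0 &
    (hweight [ffun x => (c1 x - u * c2 x)%R] * p.-1
      + hweight c1 <= hweight c1 * p.-1)%N.
Proof.
move=> es; pose k := hweight c1.
pose E (u : 'F_p) := [set x in supp c1 | c1 x == u * c2 x].
have sumE : (\sum_(u : 'F_p | u != 0%R) #|E u| = k)%N.
  rewrite /k /hweight -[RHS]sum1_card (partition_big (fun x => c1 x / c2 x) (fun u =>
    u != 0)) /=.
    apply: eq_bigr => u _; rewrite sum1dep_card; congr #|pred_of_set _|.
    apply/setP => x; rewrite !inE; case: (boolP (x \in supp c1)) => xs; last first.
      by move: xs; rewrite inE => /negPf ->.
    move: (xs); rewrite inE => -> /=; rewrite es inE in xs.
    by rewrite -[in RHS](inj_eq (mulIf xs)) divfK.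
  move=> x xs; move: (xs); rewrite {2}es !inE in xs * => c1x.
  by rewrite mulf_neq0 ?invr_eq0.
have cardnz : #|(fun u : 'F_p => u != 0)| = p.-1.
  by rewrite -card_Fp_nz; apply: eq_card => u; rewrite !inE.
(* Pigeonhole: if every class [E u] were too small, the sum over the [p.-1] classes would stay below
   [k]. *)
have [u u_nz le_k] : exists2 u : 'F_p, u != 0 & (k <= #|E u| * p.-1)%N.
  apply/exists_inP; rewrite -[X in is_true X]negbK negb_exists_in;
    apply/negP => /forall_inP lt.
  have k_gt0 : (0 < k)%N.
    have := lt 1; rewrite oner_eq0 -ltnNge => /(_ isT); exact: leq_ltn_trans.
  have: (\sum_(u : 'F_p | u != 0%R) #|E u| * p.-1 <= \sum_(u : 'F_p | u != 0%R) k.-1)%N.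
    apply: leq_sum => u /lt; rewrite -ltnNge; by case: (k) k_gt0.
  rewrite -big_distrl /= sumE sum_nat_const cardnz mulnC leq_pmul2l;
    last by case: (p) p_gt1 => [|[]].
  by rewrite leqNgt prednK // leqnn.
exists u => //.
have ek : (hweight c1 = hweight [ffun x => (c1 x - u * c2 x)%R] + #|E u|)%N.
  rewrite /hweight -[LHS](cardsID (E u)) addnC; congr (_ + _)%N.
    apply: eq_card => x; rewrite !inE ffunE subr_eq0.
    have := congr1 (fun A : {set F} => x \in A) es; rewrite !inE => /esym.
    case: (c1 x =P 0) => [->|] //=; last by rewrite andbT.
    by move/negbFE/eqP => ->; rewrite mulr0 eqxx.
  by apply: eq_card => x; rewrite !inE; case: (c1 x != 0).
by rewrite [in leqRHS]ek mulnDl leq_add2l.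
Qed.

(** * Supports and affine invariance *)

Lemma cw_lin a b h u a' b' h' :
  cw (a - emb u * a') (b - emb u * b') (h - u * h')
  = [ffun x => cw a b h x - u * cw a' b' h' x].
Proof.
apply/ffunP => x; rewrite [in RHS]ffunE !cwE /qform !mulrBl -!mulrA.
by rewrite !trD !trN !tr_scale; ring.
Qed.

Lemma coefP a : (a \in coef) = ((l.*2 == m) ==> (a ^+ (p ^ l) == a)).
Proof.
rewrite /quad_coef; case: eqP => [<-|_]; rewrite !inE //.
by rewrite doubleK.
Qed.

Lemma coef0 : 0 \in coef.
Proof. by rewrite coefP frob0 eqxx implybT. Qed.

Lemma coefB u a a' : a \in coef -> a' \in coef -> a - emb u * a' \in coef.
Proof.
rewrite !coefP; case: (l.*2 == m) => //= /eqP ea /eqP ea'.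
by rewrite frobD frobN exprMn emb_frob ea ea'.
Qed.

(** When [l.*2 = m], [v ^+ n] is the norm of [v] to the subfield of coefficients. *)
Lemma coefX a v : a \in coef -> a * v ^+ n \in coef.
Proof.
rewrite !coefP; case: eqP => //= lm /eqP ea.
by rewrite exprMn ea -exprM mulSn exprD -expnD addnn lm frob_card -exprSr.
Qed.

Lemma cw_affine a b h u v x :
  cw a b h (u * x + v)
  = cw (a * u ^+ n) (u * (polar a v + b)) (qform a v + tr (b * v) + h) x.
Proof.
rewrite !cwE qformD qform_scale.
have -> : tr (u * (polar a v + b) * x) = tr (polar a v * (u * x)) + tr (b * (u * x)).
  by rewrite -trD; congr tr; ring.
by rewrite (mulrDr b) (trD (b * _)); ring.
Qed.

(** Words are counted through their parameters; [card_blocks] determines the fibres of the support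
    map directly on these triples. *)
Definition triples k : {set F * F * 'F_p} :=
  [set s | (s.1.1 \in coef) && (hweight (cw s.1.1 s.1.2 s.2) == k)].

Lemma card_triples k : #|triples k| = (\sum_(a in coef) wcount a k)%N.
Proof.
rewrite -sum1_card (partition_big (fun s => s.1.1) (mem coef)) /=; last first.
  by move=> s; rewrite inE => /andP[].
apply: eq_bigr => a ca; rewrite sum1dep_card /wcount.
rewrite -[RHS](card_imset _ (_ : injective (fun bh : F * 'F_p => (a, bh.1, bh.2)))).
  congr #|pred_of_set _|; apply/setP => -[[a' b] h]; rewrite !inE /=.
  apply/andP/imsetP => [[/andP[_ wt] /eqP <-]|[[b' h']]].
    by exists (b, h); rewrite ?inE.
  by rewrite inE /= => wt [-> -> ->]; rewrite ca.
by move=> [b h] [b' h'] /= [-> ->].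
Qed.

Lemma blocksE k : blk k = [set supp (cw s.1.1 s.1.2 s.2) | s in triples k].
Proof.
apply/setP => B; apply/imsetP/imsetP => [[c]|[[[a b] h]]].
  rewrite inE => /andP[];
    rewrite inE => /exists_inP[a ca /existsP[b /existsP[h /eqP ->]]] wt ->.
  by exists (a, b, h); rewrite // inE /= ca.
rewrite inE /= => /andP[ca wt] ->; exists (cw a b h) => //; rewrite inE wt andbT inE.
by apply/exists_inP; exists a => //; apply/existsP; exists b; apply/existsP; exists h.
Qed.

(* Two codewords of weight k with the same support agree, up to a scalar, on a
   large part of it, so a combination of them is too light to be nonzero. *)
Lemma card_blocks k w :
  (forall a b h, a \in coef -> (a, b, h) != 0 -> (w <= hweight (cw a b h))%N) ->
  (0 < k)%N -> (k * (p - 2) < w * p.-1)%N ->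
  (#|blk k| * p.-1 = \sum_(a in coef) wcount a k)%N.
Proof.
move=> w_min k_gt0 k_lt; rewrite -card_triples blocksE.
rewrite -[RHS]sum1_card (partition_big_imset (fun s => supp (cw s.1.1 s.1.2 s.2))) /=.
rewrite (eq_bigr (fun=> p.-1)) => [|B BP]; first by rewrite sum_nat_const.
have [[[a0 b0] h0]] := imsetP BP; rewrite inE /= => /andP[c0 /eqP wt0] ->.
pose sc (u : 'F_p) : F * F * 'F_p := (emb u * a0, emb u * b0, u * h0).
have wt_gt0 : (0 < hweight (cw a0 b0 h0))%N by rewrite wt0.
have nz0 : (a0, b0, h0) != 0.
  apply: contraTneq wt_gt0 => -[-> -> ->];
    rewrite /hweight (_ : supp _ = set0) ?cards0 //.
  by apply/setP => x; rewrite !inE cwE /qform !mul0r tr0 !addr0 eqxx.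
(* Injectivity, together with the scalar range [u != 0], makes each fibre have exactly [p.-1]
   triples. *)
have sc_inj : injective sc.
  move=> u v e; have e1 : emb u * a0 = emb v * a0 := congr1 (fun s => s.1.1) e.
  have e2 : emb u * b0 = emb v * b0 := congr1 (fun s => s.1.2) e.
  have e3 : u * h0 = v * h0 := congr1 snd e.
  apply/eqP; rewrite -subr_eq0; apply/negPn/negP => uv.
  have z (x : F) : emb u * x = emb v * x -> x = 0.
    move/eqP; rewrite -subr_eq0 -mulrBl -embN -embD mulf_eq0 emb_eq0 (negPf uv).
    by move/eqP.
  have /eqP : (u - v) * h0 = 0 by rewrite mulrBl e3 subrr.
  rewrite mulf_eq0 (negPf uv) /= => /eqP h00.
  by case/negP: nz0; rewrite (z _ e1) (z _ e2) h00 eqxx.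
rewrite sum1dep_card -card_Fp_nz -(card_imset _ sc_inj); congr #|pred_of_set _|.
have scE u : cw (emb u * a0) (emb u * b0) (u * h0) = [ffun x => u * cw a0 b0 h0 x].
  have := cw_lin 0 0 0 (- u) a0 b0 h0; rewrite !embN !mulNr !opprK !add0r => ->.
  apply/ffunP => x; rewrite [LHS]ffunE [RHS]ffunE (cwE 0).
  by rewrite /qform !mul0r tr0 !add0r mulNr opprK.
apply/setP => -[[a b] h]; rewrite inE /=; apply/andP/imsetP => [[]|[u]].
  rewrite inE /= => /andP[ca /eqP wt] /eqP es.
  have [u u_nz] := same_supp es; rewrite -cw_lin wt => le_k.
  (* The combination weighs at most [k * (p - 2) / p.-1], below the minimum weight [w], so its
     parameters vanish. *)
  have e0 : (a - emb u * a0, b - emb u * b0, h - u * h0) = 0.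
    apply/eqP/negPn/negP => nz; have := w_min _ _ _ (coefB u ca c0) nz.
    rewrite leqNgt => /negP; apply; rewrite -(@ltn_pmul2r p.-1);
      last by rewrite -ltnS prednK.
    apply: leq_ltn_trans k_lt; rewrite -(leq_add2r k); apply: leq_trans le_k _.
    by case: (p) p_gt1 => [|[|s]] //= _; rewrite subn2 /= mulnS addnC.
  exists u; first by rewrite inE.
  have e1 : a - emb u * a0 = 0 := congr1 (fun s => s.1.1) e0.
  have e2 : b - emb u * b0 = 0 := congr1 (fun s => s.1.2) e0.
  have e3 : h - u * h0 = 0 := congr1 snd e0.
  by rewrite (subr0_eq e1) (subr0_eq e2) (subr0_eq e3).
rewrite inE => u_nz [-> -> ->]; rewrite scE.
have es : supp [ffun x => u * cw a0 b0 h0 x] = supp (cw a0 b0 h0).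
  by apply/setP => x; rewrite !inE ffunE mulf_eq0 (negPf u_nz).
rewrite es; split => //; rewrite inE /= scE /hweight es -/(hweight _) wt0 eqxx andbT.
rewrite -[emb u * a0]opprK -mulNr -embN -[- _]add0r.
exact: coefB coef0 c0.
Qed.

Lemma preim_affine k B u v :
  u != 0 -> B \in blk k -> (fun x => u * x + v) @^-1: B \in blk k.
Proof.
move=> u_nz; rewrite blocksE => /imsetP[[[a b] h]];
  rewrite inE /= => /andP[ca /eqP wt] ->.
pose s := (a * u ^+ n, u * (polar a v + b), qform a v + tr (b * v) + h).
have es : (fun x => u * x + v) @^-1: supp (cw a b h) = supp (cw s.1.1 s.1.2 s.2).
  by apply/setP => x; rewrite !inE cw_affine.
rewrite es; apply/imsetP; exists s => //; rewrite inE /= coefX //= -wt.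
rewrite /hweight -/s -[X in supp X]/(cw s.1.1 s.1.2 s.2) -es; apply/eqP.
rewrite on_card_preimset //; exists (fun y => (y - v) / u) => x _ /=.
  by rewrite addrK mulrC mulKf.
by rewrite mulrC divfK // subrK.
Qed.

Definition through k (x y : F) : {set {set F}} :=
  [set B in blk k | (x \in B) && (y \in B)].

Lemma through_affine k (u v x y : F) :
  u != 0 -> (#|through k (u * x + v)%R (u * y + v)%R| <= #|through k x y|)%N.
Proof.
move=> u_nz; have inj : injective (fun B : {set F} => (fun x => u * x + v) @^-1: B).
  move=> B B' /setP e; apply/setP => z; have := e ((z - v) / u).
  by rewrite !inE mulrC divfK // subrK.
rewrite -(card_imset _ inj); apply/subset_leq_card/subsetP => B' /imsetP[B].
by rewrite inE => /andP[BP xyB] ->; rewrite inE preim_affine // !inE.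
Qed.

(** The affine map sending [(0, 1)] to [(x, y)] and its inverse give the two inequalities. *)
Lemma through_const k x y :
  x != y -> #|through k x y| = #|through k 0 1|.
Proof.
move=> xy; have u_nz : y - x != 0 by rewrite subr_eq0 eq_sym.
apply: anti_leq; apply/andP; split.
  have := @through_affine k (y - x) x 0 1 u_nz.
  by rewrite mulr0 mulr1 add0r subrK.
have ui_nz : (y - x)^-1 != 0 by rewrite invr_eq0.
have := @through_affine k (y - x)^-1 (- (x / (y - x))) x y ui_nz.
by rewrite mulrC subrr [_ * y]mulrC -mulrBl divff.
Qed.

(** The second identity counts, in two ways, the blocks together with an ordered pair of distinct
    points in them. *)
Lemma is_2design_blocks k :
  is_2design (blk k) q k #|through k 0%R 1%R| /\
  (#|through k 0%R 1%R| * (q * q.-1) = #|blk k| * (k * k.-1))%N.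
Proof.
have cardB B : B \in blk k -> #|B| = k.
  by case/imsetP => c; rewrite inE => /andP[_ /eqP <-] ->.
split.
  split=> // S /eqP /cards2P[x [y [xy ->]]]; rewrite -(through_const k xy).
  by apply: eq_card => B; rewrite !inE subUset !sub1set.
pose N (B : {set F}) (s : F * F) : nat := (s.1 != s.2) && ((s.1 \in B) && (s.2 \in B)).
have count (A : {set F}) : #|[set s : F * F
  | (s.1 != s.2) && ((s.1 \in A) && (s.2 \in A))]| = (#|A| * #|A|.-1)%N.
  rewrite -sum1_card (partition_big (fun s => s.1) (mem A)) /=; last first.
    by move=> s; rewrite inE => /and3P[].
  rewrite -sum_nat_const; apply: eq_bigr => x xA; rewrite sum1dep_card.
  rewrite [in RHS](cardsD1 x) xA /=.
  rewrite -[RHS](card_imset _ (_ : injective (fun y => (x, y)))); last by move=> ? ? [].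
  congr #|pred_of_set _|; apply/setP => -[x' y]; rewrite !inE /=.
  apply/idP/imsetP => [/andP[/and3P[xy _ yA] /eqP e]|[z]].
    by exists y; rewrite ?e // !inE yA eq_sym -e xy.
  by rewrite !inE => /andP[zx zA] [-> ->]; rewrite eqxx andbT xA zA eq_sym zx.
transitivity (\sum_(B in blk k) \sum_(s : F * F) N B s)%N; last first.
  rewrite -sum_nat_const; apply: eq_bigr => B BP.
  by rewrite -big_mkcond sum1dep_card count cardB.
rewrite exchange_big /= (bigID (fun s => s.1 != s.2)) /= addnC big1 ?add0n; last first.
  by move=> s /negPf e; rewrite big1 // => B _; rewrite /N e.
rewrite (eq_bigr (fun=> #|through k 0%R 1%R|)) => [|s s_ne]; last first.
  by rewrite -(through_const k s_ne) -big_mkcondr sum1dep_card; apply: eq_card => B;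
    rewrite !inE s_ne.
rewrite sum_nat_const mulnC; congr (_ * _)%N.
rewrite -cardF -cardsT -count; apply: eq_card => s; rewrite !inE.
exact: andbT.
Qed.

(** * Radicals *)

Lemma expn_iter_fix i k (z : F) : z ^+ (p ^ i) = z -> z ^+ (p ^ (k * i)) = z.
Proof.
by move=> zi; elim: k => [|k IH]; rewrite ?expr1 // mulSn expnD exprM zi.
Qed.

Lemma frob_fix_gcd i j (z : F) :
  (0 < i)%N -> z ^+ (p ^ i) = z -> z ^+ (p ^ j) = z -> z ^+ (p ^ gcdn i j) = z.
Proof.
move=> i_gt0 zi zj; have [u v e _] := egcdnP j i_gt0.
have := expn_iter_fix u zi.
by rewrite e expnD exprM (expn_iter_fix v zj).
Qed.

(** Bezout on exponents, rearranged as [u * i = v * j + gcdn i j] to stay in the natural numbers. *)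
Lemma modn_pow_gcd g i j :
  (0 < i)%N -> p ^ i = 1 %[mod g] -> p ^ j = 1 %[mod g] -> p ^ gcdn i j = 1 %[mod g].
Proof.
move=> i_gt0 ei ej; have [u v e _] := egcdnP j i_gt0.
have: p ^ (u * i) = 1 %[mod g] by rewrite mulnC expnM -modnXm ei modnXm exp1n.
rewrite e expnD -modnMml [(v * j)%N]mulnC expnM -modnXm ej modnXm exp1n.
by rewrite modnMml mul1n.
Qed.

Lemma eqmod1_dvd g k : (0 < k)%N -> (k = 1 %[mod g]) <-> (g %| k.-1)%N.
Proof.
by move=> k_gt0; rewrite -subn1 -eqn_mod_dvd //; split=> [->|/eqP ->].
Qed.

Lemma pow_pred_dvd i j : (i %| j)%N -> ((p ^ i).-1 %| (p ^ j).-1)%N.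
Proof. by move=> /dvdnP[k ->]; rewrite mulnC expnM dvdn_pred_predX. Qed.

Lemma sqr_pred i : ((p ^ (2 * i)).-1 = (p ^ i).-1 * (p ^ i).+1)%N.
Proof.
have : (0 < p ^ i)%N by rewrite expn_gt0 p_gt0.
by rewrite mulnC expnM expnS expn1; case: (p ^ i)%N => // k _;
  rewrite mulSn addSn /=; ring.
Qed.

(** The gcd divides both [p ^ (2 * l) - 1], a multiple of [n], and [p ^ m - 1]. *)
Lemma gcd_mod_pow e :
  (0 < l)%N -> gcdn (2 * l) m = e -> p ^ e = 1 %[mod gcdn n q.-1].
Proof.
move=> l_gt0 <-; set g := gcdn _ _.
have p_pow i : (0 < p ^ i)%N by rewrite expn_gt0 p_gt0.
apply: modn_pow_gcd; rewrite ?muln_gt0 //.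
  by apply/eqmod1_dvd; rewrite // sqr_pred dvdn_mull // dvdn_gcdl.
by apply/eqmod1_dvd; rewrite // dvdn_gcdr.
Qed.

(** Modulo the gcd, [p ^ d = 1], hence [p ^ l = 1] and [n = 2]. *)
Lemma gcd_odd_quot d :
  (0 < l)%N -> (d %| l)%N -> gcdn (2 * l) m = d -> (gcdn n q.-1 %| 2)%N.
Proof.
move=> l_gt0 /dvdnP[k lE] gd; have := gcd_mod_pow l_gt0 gd; set g := gcdn _ _ => ed.
have : (g %| n)%N by rewrite dvdn_gcdl.
rewrite /dvdn -addn1 -modnDml lE mulnC expnM -modnXm ed modnXm exp1n.
by rewrite modnDml.
Qed.

Lemma pow_odd_mult d k g :
  odd k -> p ^ (2 * d) = 1 %[mod g] -> p ^ (k * d) = p ^ d %[mod g].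
Proof.
move=> k_odd e2; rewrite -(odd_double_half k) k_odd -mul2n mulnDl mul1n.
rewrite expnD -modnMmr mulnAC expnM -[X in (_ * X)%N]modnXm e2 modnXm exp1n.
by rewrite modnMmr muln1.
Qed.

(** Modulo the gcd [p ^ (2 * d) = 1], and [l] is an odd multiple of [d], so [n = p ^ d + 1].
    Conversely [p ^ d + 1] divides [n] for the same reason, and [p ^ (2 * d) - 1]. *)
Lemma gcd_even_quot d :
  (0 < l)%N -> (d %| l)%N -> odd (l %/ d) -> gcdn (2 * l) m = (2 * d)%N ->
  gcdn n q.-1 = (p ^ d).+1.
Proof.
move=> l_gt0 dv od gd; have := gcd_mod_pow l_gt0 gd; set g := gcdn _ _ => ed.
have p_pow i : (0 < p ^ i)%N by rewrite expn_gt0 p_gt0.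
apply/eqP; rewrite eqn_dvd; apply/andP; split.
  have : (g %| n)%N by rewrite dvdn_gcdl.
  rewrite /dvdn -addn1 -modnDml -(divnK dv).
  by rewrite (pow_odd_mult od ed) modnDml addn1.
have e2 : p ^ (2 * d) = 1 %[mod (p ^ d).+1].
  by apply/eqmod1_dvd; rewrite // sqr_pred dvdn_mull.
rewrite dvdn_gcd; apply/andP; split.
  by rewrite /dvdn -addn1 -modnDml -(divnK dv) (pow_odd_mult od e2) modnDml addn1 modnn.
apply: dvdn_trans (pow_pred_dvd (dvdn_gcdr (2 * l) m)).
by rewrite gd sqr_pred dvdn_mull.
Qed.

(** Scalars satisfy [x ^+ p.-1 = 1], and [p.-1] times the gcd divides [p ^ (2 * e) - 1], hence
    [q.-1]; this is the criterion of [ex_nth_root]. *)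
Lemma ex_root_Fp e (u : 'F_p) :
  (2 * e %| m)%N -> (gcdn n q.-1 %| (p ^ e).+1)%N -> u != 0 ->
  exists2 v : F, v != 0 & v ^+ n = emb u.
Proof.
move=> e_dv g_dv u_nz; apply: ex_nth_root; rewrite ?emb_eq0 //.
have e_u : emb u ^+ p.-1 = 1.
  apply: (@mulIf _ (emb u)); first by rewrite emb_eq0.
  by rewrite -exprSr prednK // mul1r -[p in _ ^+ p]expn1 emb_frob.
have /dvdnP[k ->] : (p.-1 %| q.-1 %/ gcdn n q.-1)%N.
  rewrite dvdn_divRL ?dvdn_gcdr //; apply: dvdn_trans (pow_pred_dvd e_dv).
  by rewrite sqr_pred dvdn_mul // -[p in (p.-1 %| _)%N]expn1 pow_pred_dvd ?dvd1n.
by rewrite mulnC exprM e_u expr1n.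
Qed.

(** Multiply the equation of [polar_eq0] by [y ^+ (p ^ l)]. *)
Lemma radical_norm a y :
  y \in radical a -> (a * y ^+ n) ^+ (p ^ l) = - (a * y ^+ n).
Proof.
rewrite inE polar_eq0 => /eqP e; rewrite exprMn -exprM mulSn exprD -expnD addnn.
by rewrite -mul2n mulrCA e exprS; ring.
Qed.

(** A nonzero [y] in the radical gives [z = a * y ^+ n] with [z ^+ (p ^ l) = - z]. Then [z] is fixed
    by the Frobenius powers [2 * l] and [m], so by [d], so by [l]: this forces [z = - z]. *)
Lemma radical_odd d a :
  (0 < l)%N -> (d %| l)%N -> gcdn (2 * l) m = d -> a != 0 -> #|radical a| = 1%N.
Proof.
move=> l_gt0 /dvdnP[k lE] gd a_nz; suff -> : radical a = [set 0] by rewrite cards1.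
apply/setP => y; rewrite in_set1; apply/idP/eqP => [ky|->]; last by rewrite inE polar0.
apply/eqP; apply: contraT => y_nz.
have zl := radical_norm ky; set z := a * y ^+ n in zl.
have z_nz : z != 0 by rewrite mulf_neq0 ?expf_neq0.
have z2l : z ^+ (p ^ (2 * l)) = z.
  by rewrite mul2n -addnn expnD exprM zl frobN zl opprK.
have zd : z ^+ (p ^ d) = z.
  by rewrite -gd frob_fix_gcd ?muln_gt0 ?frob_card.
move: zl; rewrite lE expn_iter_fix // => /eqP.
by rewrite -addr_eq0 -mulr2n -mulr_natr mulf_eq0 (negPf two_nz) orbF (negPf z_nz).
Qed.

(** Here [a] and [y] are fixed by the Frobenius powers [l] and [2 * l], so the radical equation
    becomes [a * y = - (a * y)]. *)
Lemma radical_subfield a :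
  (l.*2 == m)%N -> a \in coef -> a != 0 -> #|radical a| = 1%N.
Proof.
move=> lm; rewrite coefP lm => /eqP ea a_nz.
suff -> : radical a = [set 0] by rewrite cards1.
apply/setP => y; rewrite inE in_set1 polar_eq0 ea mul2n (eqP lm) frob_card.
rewrite -addr_eq0 -mulr2n -mulr_natr !mulf_eq0 (negPf two_nz) orbF.
by rewrite (negPf a_nz).
Qed.

Lemma card_frob_fix e :
  (0 < e)%N -> (e %| m)%N -> #|[set w : F | w ^+ (p ^ e) == w]| = (p ^ e)%N.
Proof.
move=> e_gt0 e_dv; rewrite (cardsD1 0) inE frob0 eqxx.
rewrite -[RHS]prednK ?expn_gt0 ?p_gt0 // -(card_unity_roots (pow_pred_dvd e_dv)).
congr _.+1; congr #|pred_of_set _|; apply/setP => w; rewrite !inE.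
have p_pow : (0 < p ^ e)%N by rewrite expn_gt0 p_gt0.
have [->|w_nz] := eqVneq w 0 => /=.
  have : (0 < (p ^ e).-1)%N by rewrite -ltnS prednK // -(expn0 p) ltn_exp2l.
  by case: _.-1 => // k _; rewrite expr0n eq_sym oner_eq0.
by rewrite -[in RHS](inj_eq (mulIf w_nz)) /= -exprSr prednK // mul1r.
Qed.

(** If [y0] is a nonzero element of the radical, then the radical is [y0] times the subfield with
    [p ^ (2 * d)] elements. *)
Lemma radical_even d a :
  (0 < l)%N -> gcdn (2 * l) m = (2 * d)%N -> a != 0 ->
  #|radical a| = 1%N \/ #|radical a| = (p ^ (2 * d))%N.
Proof.
move=> l_gt0 gd a_nz.
have d_gt0 : (0 < 2 * d)%N by rewrite -gd gcdn_gt0 muln_gt0 l_gt0.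
have [y0 /= /andP[]|no_y] := pickP [pred y | (y \in radical a) && (y != 0)].
  move=> ky0 y0_nz; right.
  rewrite -(@card_frob_fix (2 * d)) //; last by rewrite -gd dvdn_gcdr.
  rewrite -[RHS](card_imset _ (mulfI y0_nz)); congr #|pred_of_set _|.
  have fixE w : (y0 * w \in radical a) = (w ^+ (p ^ (2 * d)) == w).
    move: ky0; rewrite !inE !polar_eq0 => /eqP ky0.
    have -> : (a ^+ (p ^ l) * (y0 * w) ^+ (p ^ (2 * l)) == - (a * (y0 * w)))
             = (w ^+ (p ^ (2 * l)) == w).
      rewrite exprMn mulrA ky0 [a * (_ * _)]mulrA -[- (a * y0 * w)]mulNr.
      by rewrite (inj_eq (mulfI _)) // oppr_eq0 mulf_neq0.
    apply/eqP/eqP => ew; first by rewrite -gd frob_fix_gcd ?muln_gt0 ?frob_card.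
    have /dvdnP[k ->] : (2 * d %| 2 * l)%N by rewrite -gd dvdn_gcdl.
    exact: expn_iter_fix.
  apply/setP => y; apply/idP/imsetP => [ky|[w]].
    have yE : y0 * (y / y0) = y by rewrite mulrC divfK.
    by exists (y / y0); rewrite // inE -fixE yE.
  by rewrite inE => w_fix ->; rewrite fixE.
left; suff -> : radical a = [set 0] by rewrite cards1.
apply/setP => y; rewrite in_set1; apply/idP/eqP => [ky|->]; last by rewrite inE polar0.
by have := no_y y; rewrite /= ky /= => /negbFE/eqP.
Qed.

(** * Level sizes *)

(** The [p.-1] nonzero scalars already exhaust the roots of unity of that order. *)
Lemma Fp_of_root (x : F) : x ^+ p.-1 = 1 -> exists2 u : 'F_p, u != 0 & x = emb u.
Proof.
move=> x1; have p1_dv : (p.-1 %| q.-1)%N.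
  by rewrite -[p in (p.-1 %| _)%N]expn1 pow_pred_dvd ?dvd1n.
have : x \in [set emb u | u in [set u : 'F_p | u != 0]].
  suff -> : [set emb u | u in [set u : 'F_p | u != 0]] = [set x | x ^+ p.-1 == 1].
    by rewrite inE x1.
  apply/eqP; rewrite eqEcard card_unity_roots // card_imset; last exact: emb_inj.
  rewrite card_Fp_nz leqnn andbT; apply/subsetP => y /imsetP[u].
  rewrite !inE => u_nz ->; apply/eqP.
  apply: (@mulIf _ (emb u)); first by rewrite emb_eq0.
  by rewrite -exprSr prednK // mul1r -[p in _ ^+ p]expn1 emb_frob.
by case/imsetP => u; rewrite inE => u_nz ->; exists u.
Qed.

(** Scaling the form by [t] moves level 1 to level [t]; as [t] is [v ^+ n], the same scaling is a
    substitution in [x]. *)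
Lemma level_const a (t : 'F_p) :
  (forall u : 'F_p, u != 0 -> exists2 v : F, v != 0 & v ^+ n = emb u) ->
  t != 0 -> level a t = level a 1.
Proof.
move=> roots t_nz; have [v v_nz vt] := roots t t_nz.
by rewrite -[RHS](level_emb _ _ t_nz) mulr1 mulrC -vt level_scale.
Qed.

(* This integer is the exponential sum of the quadratic form when it takes all
   nonzero values equally often. *)
Definition excess a : int := (level a 0)%:Z - (level a 1)%:Z.

Lemma predpE : p.-1%:Z = p%:Z - 1.
Proof. by rewrite -subn1 -subzn. Qed.

(** [E] is the deviation of the weight from the balanced weight, [S] that of the level size scaled
    by [p]; indeed [p * (k + N - q) = p * E - S]. *)
Lemma weight_complement k (E : int) (N : nat) (S : int) :
  k%:Z = q%:Z - (p ^ (m - 1))%N%:Z + E -> p%:Z * N%:Z = q%:Z - S ->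
  (k + N == q)%N = (p%:Z * E == S).
Proof.
move=> kE pN; have qE : q%:Z = p%:Z * (p ^ (m - 1))%N%:Z.
  by rewrite -PoszM -expnS subn1 prednK //; apply: leq_ltn_trans l_lt.
have p_nz : p%:Z != 0 by case: (p) p_gt1.
rewrite -eqz_nat -[RHS]subr_eq0 -[LHS]subr_eq0 -[LHS](inj_eq (mulfI p_nz)).
rewrite mulr0 PoszD kE; congr (_ == 0); move: pN qE.
move: (p ^ (m - 1))%N%:Z (q%:Z) (p%:Z) => r Q P pN qE.
rewrite mulrBr mulrDr pN mulrDr qE mulrBr; ring.
Qed.

Lemma level_00 t : level 0 t = (if t == 0%R then q else 0)%N.
Proof.
case: eqP => [->|/eqP t_nz].
  by rewrite -cardF -cardsT; apply: eq_card => x; rewrite !inE /qform mul0r tr0 eqxx.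
by apply: eq_card0 => x; rewrite !inE /qform mul0r tr0 eq_sym (negPf t_nz).
Qed.

Lemma radical_0 : #|radical 0| = q.
Proof.
rewrite -cardF -cardsT; apply: eq_card => x.
by rewrite !inE /polar !mul0r frob0 addr0 eqxx.
Qed.

Lemma balanced_weight k (E : int) :
  k%:Z = q%:Z - (p ^ (m - 1))%N%:Z + E ->
  (k * p + q == q * p)%N = (E == 0).
Proof.
move=> kE; have qE : q%:Z = p%:Z * (p ^ (m - 1))%N%:Z.
  by rewrite -PoszM -expnS subn1 prednK //; apply: leq_ltn_trans l_lt.
have p_nz : p%:Z != 0 by case: (p) p_gt1.
rewrite -eqz_nat PoszD !PoszM kE -[LHS]subr_eq0 -[RHS](inj_eq (mulfI p_nz)) mulr0.
congr (_ == 0); move: qE; move: (p ^ (m - 1))%N%:Z (q%:Z) (p%:Z) => r Q P ->; ring.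
Qed.

(** * Forms that take all nonzero values equally often *)

Section EvenRank.

Hypothesis roots :
  forall u : 'F_p, u != 0 -> exists2 v : F, v != 0 & v ^+ n = emb u.

Lemma sum_level_even a : (level a 0%R + p.-1 * level a 1%R = q)%N.
Proof.
rewrite -(sum_level a) (bigD1 0) //=; congr (_ + _)%N.
rewrite (eq_bigr (fun=> level a 1)) => [|t t_nz]; last exact: level_const.
rewrite sum_nat_const -card_Fp_nz; congr (_ * _)%N.
by apply: eq_card => t; rewrite !inE.
Qed.

Lemma level0_excess a : p%:Z * (level a 0)%:Z = q%:Z + (p%:Z - 1) * excess a.
Proof.
by rewrite -(sum_level_even a) /excess PoszD PoszM predpE; ring.
Qed.

Lemma level1_excess a : p%:Z * (level a 1)%:Z = q%:Z - excess a.
Proof.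
by rewrite -(sum_level_even a) /excess PoszD PoszM predpE; ring.
Qed.

(** The second moment [sum_level_sqr], evaluated with the two level sizes expressed through
    [excess a]. *)
Lemma excess_sqr a : excess a ^+ 2 = q%:Z * #|radical a|%:Z.
Proof.
have := sum_level_sqr a.
have -> : (\sum_t level a t ^ 2 = level a 0%R ^ 2 + p.-1 * level a 1%R ^ 2)%N.
  rewrite (bigD1 0) //=; congr (_ + _)%N.
  rewrite (eq_bigr (fun=> (level a 1%R ^ 2)%N)) => [|t t_nz];
    last by rewrite level_const.
  rewrite sum_nat_const -card_Fp_nz; congr (_ * _)%N.
  by apply: eq_card => t; rewrite !inE.
rewrite -!mulnn => /(congr1 Posz); rewrite !(PoszD, PoszM).
have e0 := level0_excess a; have e1 := level1_excess a.
have p1_nz : p%:Z - 1 != 0 by rewrite -predpE; case: (p) p_gt1 => [|[]].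
rewrite predpE => e; apply: (mulfI p1_nz) => /=.
have P_nz : p%:Z != 0 by case: (p) p_gt1.
apply: (mulfI P_nz) => /=; move: e e0 e1.
move: (excess a) (level a 0)%:Z (level a 1)%:Z (q%:Z) (#|radical a|%:Z) (p%:Z) => S
  N0 N1 Q r P e e0 e1.
(* The cross terms in [Q * S] from the two squares cancel. *)
have p_e : P * (P * (N0 * N0 + (P - 1) * (N1 * N1))) = P * (Q * Q + (P - 1) * S ^+ 2).
  transitivity ((P * N0) ^+ 2 + (P - 1) * (P * N1) ^+ 2); first by ring.
  by rewrite e0 e1; ring.
have := congr1 (fun z => P * z) e.
lia.
Qed.

(** By [sum_level0] the zero sets of the forms with [a != 0] have mean size [q / p], and [excess a]
    is proportional to the deviation from it. *)
Lemma sum_excess : \sum_(a | a != 0) excess a = 0.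
Proof.
have := sum_level0; rewrite (bigD1 0) //=.
have -> : level 0 0 = q.
  by rewrite -cardF -cardsT; apply: eq_card => x; rewrite !inE /qform mul0r tr0 eqxx.
rewrite mulnDl => /addnI/(congr1 Posz).
rewrite !PoszM (big_morph Posz PoszD (erefl _)) mulr_suml.
rewrite (eq_bigr (fun a => q%:Z + (p%:Z - 1) * excess a)) => [|a _]; last first.
  by rewrite mulrC level0_excess.
rewrite big_split /= sumr_const cardC1 cardF -mulr_sumr -mulr_natl natz.
rewrite -[RHS]addr0 => /addrI/eqP; rewrite mulf_eq0 -predpE.
by case/orP => /eqP // /eqP; case: (p) p_gt1 => [|[]].
Qed.

(** Without the point 0, both level sets have size divisible by the gcd. *)
Lemma excess_mod a : (gcdn n q.-1 %| excess a - 1)%Z.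
Proof.
have l0_gt0 : (0 < level a 0)%N by apply/card_gt0P; exists 0; rewrite inE qform0.
have -> : excess a - 1 = (level a 0%R - 1)%N%:Z - (level a 1%R)%:Z.
  by rewrite -subzn // /excess; ring.
have d0 : ((gcdn n q.-1)%:Z %| (level a 0 - 1)%N%:Z)%Z by exact: (level_dvd a 0).
have d1 : ((gcdn n q.-1)%:Z %| (level a 1)%:Z)%Z.
  by have := level_dvd a 1; rewrite oner_eq0 subn0.
exact: rpredB d0 d1.
Qed.

(** The three indicators come from the level 0, from the [p - 1] equal nonzero levels, and from the
    balanced words. *)
Lemma wcount_even a k (E : int) :
  (k%:Z = q%:Z - (p ^ (m - 1))%N%:Z + E) ->
  #|radical a|%:Z * (wcount a k)%:Z =
  q%:Z * ((p%:Z * E == - ((p%:Z - 1) * excess a))%:Z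
    + (p%:Z - 1) * (p%:Z * E == excess a)%:Z)
  + (#|radical a|%:Z - 1) * (q%:Z * p%:Z * (E == 0)%:Z).
Proof.
move=> kE; rewrite -PoszM wcountE (balanced_weight kE).
have -> : (#|[set t | k + level a t == q]| =
  (k + level a 0%R == q) + p.-1 * (k + level a 1%R == q))%N.
  rewrite -sum1dep_card big_mkcond (bigD1 0) //=; congr (_ + _)%N.
  rewrite (eq_bigr (fun=> nat_of_bool (k + level a 1%R == q)%N)) => [|t t_nz];
    last first.
    by rewrite level_const //; case: (_ == q).
  rewrite sum_nat_const -card_Fp_nz; congr (_ * _)%N.
  by apply: eq_card => t; rewrite !inE.
rewrite (@weight_complement k E (level a 0) (- ((p%:Z - 1) * excess a))) //; last first.
  by rewrite level0_excess opprK.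
rewrite (weight_complement kE (level1_excess a)).
have rE : #|radical a|.-1%:Z = #|radical a|%:Z - 1.
  by rewrite -subn1 -subzn // radical_gt0.
by rewrite !(PoszD, PoszM) predpE rE.
Qed.

End EvenRank.

(** For [a = 0] the words with [b = 0] are constant, of weight 0 or [q], which the bounds on [k]
    exclude; the others are balanced. *)
Lemma wcount_0 k (E : int) :
  (0 < k < q)%N -> k%:Z = q%:Z - (p ^ (m - 1))%N%:Z + E ->
  (wcount 0 k)%:Z = (q%:Z - 1) * p%:Z * (E == 0)%:Z.
Proof.
move=> /andP[k_gt0 k_lt] kE.
have q_nz : q%:Z != 0 by rewrite -lt0n expn_gt0 p_gt0.
apply: (mulfI q_nz); rewrite -PoszM -[X in (X * _)%N]radical_0 wcountE
  (balanced_weight kE).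
have -> : #|[set t | (k + level 0%R t == q)%N]| = 0%N.
  apply: eq_card0 => t; rewrite !inE level_00; case: ifP => _.
    by rewrite -[X in _ == X]add0n eqn_add2r gtn_eqF.
  by rewrite addn0 ltn_eqF.
have rE : #|radical 0|.-1%:Z = q%:Z - 1.
  by rewrite radical_0 -subn1 -subzn // expn_gt0 p_gt0.
by rewrite !(PoszD, PoszM) rE; ring.
Qed.

Lemma square_nth_root (x : F) :
  (gcdn n q.-1 %| 2)%N -> x != 0 -> exists2 v : F, v != 0 & v ^+ n = x ^+ 2.
Proof.
move=> /dvdnP[k k2] x_nz; apply: ex_nth_root; rewrite ?expf_neq0 //.
rewrite -exprM k2 -mulnA [(gcdn _ _ * _)%N]mulnC divnK ?dvdn_gcdr //.
by rewrite mulnC exprM expf_pred // expr1n.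
Qed.

Lemma odd_sum_pow k : odd (\sum_(i < k) p ^ i) = odd k.
Proof.
by elim: k => [|k IH]; rewrite ?big_ord0 // big_ord_recr oddD IH oddX p_odd orbT addbT.
Qed.

(* The exponent (q - 1) / (p - 1) is odd and sends a into 'F_p. *)
Lemma scalar_square (a : F) :
  odd m -> a != 0 -> exists u : 'F_p, exists w : F, [/\ u != 0, w != 0 & a =
    emb u * w ^+ 2].
Proof.
move=> m_odd a_nz; pose K := (\sum_(i < m) p ^ i)%N.
have [j jK] : exists j, K = (j.*2.+1)%N.
  by exists K./2; rewrite -[LHS]odd_double_half odd_sum_pow m_odd.
have [u u_nz uE] : exists2 u : 'F_p, u != 0 & a ^+ K = emb u.
  by apply: Fp_of_root; rewrite -exprM mulnC -predn_exp expf_pred.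
exists u, (a ^- j); rewrite u_nz invr_eq0 expf_neq0 //; split=> //.
by rewrite -uE jK exprS -mul2n mulnC exprM exprVn mulfK // !expf_neq0.
Qed.

(** * Forms over an extension of odd degree *)

Section OddRank.

Hypotheses (m_odd : odd m) (g_dv : (gcdn n q.-1 %| 2)%N).
Hypothesis radical1 : forall a, a != 0 -> #|radical a| = 1%N.

(** Any nonzero [a] is a scalar times some [v ^+ n], and neither factor changes the size of the zero
    set; its common value is then the mean given by [sum_level0]. *)
Lemma level0_odd a : a != 0 -> (p * level a 0 = q)%N.
Proof.
have const b : b != 0 -> level b 0 = level 1 0.
  move=> b_nz; have [u [w [u_nz w_nz ->]]] := scalar_square m_odd b_nz.
  have [v v_nz <-] := square_nth_root g_dv w_nz.
  by rewrite -[X in level _ X](mulr0 u) level_emb // -[v ^+ n]mul1r level_scale.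
move=> a_nz; rewrite const //.
have := sum_level0; rewrite (bigD1 0) //= level_00 eqxx.
rewrite (eq_bigr (fun=> level 1 0)) => [|b b_nz]; last exact: const.
rewrite sum_nat_const cardC1 cardF mulnDl => /addnI/eqP.
by rewrite -mulnA eqn_pmul2l ?pred_q_gt0 // mulnC => /eqP.
Qed.

Lemma level_square a (u t : 'F_p) : u != 0 -> level a (u ^+ 2 * t) = level a t.
Proof.
move=> u_nz; have [|v v_nz vE] := square_nth_root g_dv (x := emb u).
  by rewrite emb_eq0.
rewrite -(level_scale _ _ v_nz) vE mulrC expr2 -embM -expr2 level_emb //.
by rewrite expf_neq0.
Qed.

(** [N] is constant on the nonzero squares and on the nonsquares, two classes of equal size. The
    quantifier over [f] lets moments and indicators share the same two values. *)
Lemma sum_square_classes (N : 'F_p -> nat) :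
  (forall u t, u != 0 -> N (u ^+ 2 * t) = N t) ->
  exists x y : nat, forall f : nat -> nat,
    (\sum_(t | t != 0%R) f (N t) = p.-1./2 * (f x + f y))%N.
Proof.
move=> Nsq; pose nz := [set u : 'F_p | u != 0]; pose Sq := [set u ^+ 2 | u in nz].
have neq u : u != 0 -> u != - u :> 'F_p.
  by move=> u_nz; apply: contra_neq u_nz => e; apply: Fp_double_eq0; rewrite {1}e addNr.
have cardSq2 : (#|Sq| * 2 = p.-1)%N.
  rewrite -card_Fp_nz -/nz -[RHS]sum1_card (partition_big_imset (fun u : 'F_p => u ^+
    2)) /=.
  rewrite -sum_nat_const; apply: eq_bigr => s /imsetP[u]; rewrite inE => u_nz ->.
  (* The fibre of squaring over [u ^+ 2] is the pair of [u] and [- u]; [true.+1] matches the form of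
     [cards2]. *)
  rewrite sum1dep_card -[LHS]/(true.+1) -(neq u u_nz) -cards2; congr #|pred_of_set _|.
  apply/setP => v; rewrite !inE eqf_sqr; apply/idP/andP => [/orP[]/eqP ->|[]//].
    by rewrite u_nz eqxx.
  by rewrite oppr_eq0 u_nz eqxx orbT.
have cardSq : #|Sq| = p.-1./2 by rewrite -cardSq2 muln2 doubleK.
have sub_nz : Sq \subset nz.
  by apply/subsetP => s /imsetP[u]; rewrite !inE => u_nz ->; rewrite expf_neq0.
(* A nonsquare exists since the squares make up only half of [nz]; the other class is the coset of
   [t0]. *)
have [t0 t0_nz t0S] : exists2 t0, t0 \in nz & t0 \notin Sq.
  have: ~~ (nz \subset Sq).
    apply/negP => /subset_leq_card;
      rewrite card_Fp_nz -cardSq2 muln2 -addnn -{3}[#|Sq|]addn0.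
    rewrite leq_add2l leqn0 => /eqP S0; move: cardSq2; rewrite S0 mul0n.
    by move/esym; case: (p) p_gt1 => [|[]].
  by case/subsetPn => t0; exists t0.
rewrite inE in t0_nz; pose Sq' := [set t0 * s | s in Sq].
have disj : [disjoint Sq & Sq'].
  rewrite -setI_eq0; apply/eqP/setP => s; rewrite !inE; apply/negP => /andP[].
  case/imsetP => u; rewrite inE => u_nz -> /imsetP[_ /imsetP[v v_nz ->] e].
  rewrite inE in v_nz; case/negP: t0S; apply/imsetP; exists (u / v).
    by rewrite inE mulf_neq0 ?invr_eq0.
  by rewrite expr_div_n e mulfK // expf_neq0.
have nzE : nz = Sq :|: Sq'.
  apply/esym/eqP; rewrite eqEcard subUset sub_nz /=; apply/andP; split.
    apply/subsetP => _ /imsetP[s sS ->]; move/subsetP: sub_nz => /(_ s sS).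
    by rewrite !inE => s_nz; rewrite mulf_neq0.
  rewrite card_Fp_nz -cardSq2 cardsU disjoint_setI0 // cards0 subn0.
  by rewrite (card_imset _ (mulfI t0_nz)) muln2 addnn.
exists (N 1), (N t0) => f.
have nzP t : (t != 0) = (t \in [predU Sq & Sq']).
  by have /setP/(_ t) := nzE; rewrite [LHS]inE in_setU => ->; rewrite !inE.
rewrite (eq_bigl _ _ nzP) bigU //= mulnDr; congr (_ + _)%N.
  rewrite (eq_bigr (fun=> f (N 1))) => [|s /imsetP[u]].
    by rewrite sum_nat_const cardSq.
  by rewrite inE => u_nz ->; rewrite -[_ ^+ 2]mulr1 Nsq.
rewrite (eq_bigr (fun=> f (N t0))) => [|s /imsetP[s' /imsetP[u]]].
  by rewrite sum_nat_const (card_imset _ (mulfI t0_nz)) cardSq.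
by rewrite inE => u_nz -> ->; rewrite mulrC Nsq.
Qed.

(** With [e] set to [q - p * x], the total of the level sizes forces [p * y = q + e], and the second
    moment with trivial radical gives [e ^+ 2]. *)
Lemma level_odd a :
  a != 0 -> exists x y : nat, exists e : int,
  [/\ e ^+ 2 = p%:Z * q%:Z, p%:Z * x%:Z = q%:Z - e, p%:Z * y%:Z = q%:Z + e &
      forall f : nat -> nat,
      (\sum_t f (level a t) = f (level a 0) + p.-1./2 * (f x + f y))%N].
Proof.
move=> a_nz; have [x [y fE]] := sum_square_classes (@level_square a).
have {}fE f : (\sum_t f (level a t) = f (level a 0) + p.-1./2 * (f x + f y))%N.
  by rewrite (bigD1 0) //= fE.
exists x, y, (q%:Z - p%:Z * x%:Z).
have halfE : p%:Z = 2 * p.-1./2%:Z + 1.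
  rewrite -[p in LHS](prednK p_gt0) -[X in X.+1](odd_double_half p.-1).
  have -> : odd p.-1 = false by move: p_odd;
    rewrite -[p in odd p](prednK p_gt0) /= => /negPf.
  by rewrite add0n -addn1 PoszD -muln2 PoszM; ring.
have h_nz : p.-1./2%:Z != 0.
  by apply: contraTneq p_gt1 => h0; rewrite -ltz_nat halfE h0 mulr0 add0r ltxx.
have l0 := congr1 Posz (level0_odd a_nz).
have s1 := congr1 Posz (fE id); rewrite /= sum_level in s1.
have s2 := sum_level_sqr a; rewrite (fE (expn^~ 2)) /= radical1 // -!mulnn in s2.
move/(congr1 Posz): s2; rewrite !(PoszD, PoszM) => s2.
rewrite !(PoszD, PoszM) in s1 l0; move: s1 s2 l0 halfE h_nz.
move: (x%:Z) (y%:Z) (level a 0)%:Z (q%:Z) (p%:Z) (p.-1./2%:Z) => X Y N Q P h s1 s2 l0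
  PE h_nz.
have e1 : P * Y = Q + (Q - P * X).
  apply: (mulfI h_nz); have := congr1 (fun z => P * z) s1;
    rewrite !mulrDr l0 [in LHS]PE.
  lia.
split=> //; last by ring.
have P2 : P * ((N * N + h * (X * X + Y * Y)) * P) + P * Q = P * (Q * P) + P * (Q * Q).
  by rewrite -[LHS]mulrDr -[RHS]mulrDr; move: s2; rewrite !mul1r => ->.
have lhs : P * ((N * N + h * (X * X + Y * Y)) * P) =
  Q * Q + 2 * h * (Q * Q + (Q - P * X) ^+ 2).
  transitivity ((P * N) * (P * N) + h * ((P * X) * (P * X) + (P * Y) * (P * Y)));
    first by ring.
  by rewrite l0 e1; ring.
apply: (mulfI h_nz); apply: (mulfI (isT : 2 != 0 :> int)).
rewrite {}lhs in P2.
move: (Q - P * X) P2 => e P2.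
have -> : 2 * (h * (P * Q)) = P * (Q * P) + P * (Q * Q) - P * Q - P * (Q * Q).
  by rewrite PE; ring.
by rewrite -P2 PE; ring.
Qed.

Lemma wcount_odd a k (E s : int) :
  a != 0 -> k%:Z = q%:Z - (p ^ (m - 1))%N%:Z + E -> q%:Z = p%:Z * s ^+ 2 ->
  (wcount a k)%:Z = q%:Z * ((E == 0)%:Z + p.-1./2%:Z * ((E == s)%:Z + (E == - s)%:Z)).
Proof.
move=> a_nz kE qs; have [x [y [e [e2 xE yE fE]]]] := level_odd a_nz.
have p_nz : p%:Z != 0 by case: (p) p_gt1.
have := wcountE a k; rewrite radical1 // mul1n mul0n addn0 => ->; rewrite PoszM.
congr (_ * _).
have -> : #|[set t | k + level a t == q]| = (\sum_t (k + level a t == q))%N.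
  by rewrite -sum1dep_card big_mkcond.
rewrite (fE (fun N => nat_of_bool (k + N == q)%N)).
rewrite (weight_complement kE xE) (@weight_complement k E y (- e)) ?opprK //.
rewrite (@weight_complement k E (level a 0) 0) //;
  last by rewrite -PoszM level0_odd // subr0.
have : e ^+ 2 = (p%:Z * s) ^+ 2 by rewrite e2 qs exprMn expr2; ring.
have mulI z w : (p%:Z * z == p%:Z * w) = (z == w) by rewrite (inj_eq (mulfI p_nz)).
(* The sign of [e] is unknown, but it only exchanges the two classes, which enter symmetrically. *)
move/eqP; rewrite eqf_sqr PoszD PoszM PoszD => /orP[]/eqP ->.
  by rewrite -mulrN -[X in _ == X](mulr0 p%:Z) !mulI.
by rewrite opprK -mulrN -[X in _ == X](mulr0 p%:Z) !mulI [_ + (E == s)%:Z]addrC.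
Qed.

End OddRank.

(** * From weight counts to designs *)

(** This bound on the level sizes supplies the minimum weight that [card_blocks] requires. *)
Definition near_uniform : Prop :=
  forall a t, a \in coef -> a != 0 ->
  `|q%:Z - p%:Z * (level a t)%:Z| <= (p%:Z - 1) * (p ^ (m - 2))%N%:Z.

Section Designs.

Hypotheses (m_gt2 : (2 < m)%N) (levels : near_uniform).

Let X : int := (p ^ (m - 3))%N%:Z.
Let P : int := p%:Z.

Let XE : [/\ (p ^ (m - 2))%N%:Z = P * X, (p ^ (m - 1))%N%:Z = P ^+ 2 * X & q%:Z =
  P ^+ 3 * X].
Proof.
rewrite /P /X; have -> : (m - 2 = (m - 3).+1)%N by lia.
have -> : (m - 1 = (m - 3).+2)%N by lia.
have mE : (m = (m - 3).+3)%N by lia.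
by rewrite [in q]mE !expnS !PoszM; split; ring.
Qed.

Let X_gt0 : 0 < X.
Proof. by rewrite /X ltz_nat expn_gt0 p_gt0. Qed.

Let P_ge3 : 3%:Z <= P.
Proof. by rewrite /P lez_nat; case: (p) p_gt1 p_odd => [|[|[]]]. Qed.

(** Balanced words exceed the bound, nonzero constants weigh [q], and the remaining words have
    [a != 0] and are controlled by [levels]. *)
Lemma hweight_ge a b h :
  a \in coef -> (a, b, h) != 0 ->
  q%:Z - (p ^ (m - 1))%N%:Z - (P - 1) * X <= (hweight (cw a b h))%:Z.
Proof.
have [_ rE qE] := XE; rewrite rE.
move=> ca nz; case: (boolP (b \in orth a)) => [|b_bal]; last first.
  have := congr1 Posz (hweight_balanced h b_bal); rewrite PoszD !PoszM -/P qE.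
  by move: X_gt0 P_ge3; move: (hweight _)%:Z => w; nia.
rewrite orthE => /imsetP[v _ bE]; have := congr1 Posz (hweight_polar a v h).
rewrite -bE PoszD; have [a0|a_nz] := eqVneq a 0.
  have b0 : b = 0 by rewrite bE a0 /polar !mul0r frob0 addr0.
  have h_nz : h != 0 by apply: contraNneq nz => ->; rewrite a0 b0.
  rewrite a0 b0 level_00 /qform mul0r tr0 sub0r oppr_eq0 (negPf h_nz) addr0 => ->.
  by rewrite qE; move: X_gt0 P_ge3; nia.
have [dE _ _] := XE; have := levels (qform a v - h) ca a_nz; rewrite -/P dE.
rewrite ler_norml => /andP[lo _] wE.
by move: lo wE X_gt0 P_ge3; rewrite qE; move: (hweight _)%:Z (level _ _)%:Z => w N; nia.
Qed.

(** [A / B] is the number of words of weight [i]. Dividing by [p - 1] gives the number of blocks,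
    and the pair count of [is_2design_blocks] then determines [lam]. *)
Lemma holds_design (E A B : int) (i lam : rat) :
  B != 0 ->
  `|E| <= (P - 1) * X ->
  i = (q%:Z - (p ^ (m - 1))%N%:Z + E)%:~R ->
  (forall k, (0 < k < q)%N -> k%:Z = q%:Z - (p ^ (m - 1))%N%:Z + E ->
     B * (\sum_(a in coef) wcount a k)%N%:Z = A) ->
  A%:~R * (i * (i - 1)) = lam * (B%:~R * ((p%:R - 1) * (q%:R * (q%:R - 1)))) ->
  holds_2design p m l F i lam.
Proof.
move=> B_nz; have [_ rE qE] := XE.
rewrite ler_norml => /andP[E_lo E_hi] iE count lamE.
pose k := absz (q%:Z - (p ^ (m - 1))%N%:Z + E)%R.
have kE : k%:Z = q%:Z - (p ^ (m - 1))%N%:Z + E.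
  by rewrite /k gez0_abs // rE qE; move: X_gt0 P_ge3 E_lo; nia.
have k_lt : (0 < k < q)%N.
  by rewrite -!ltz_nat kE rE qE; apply/andP; split; move: X_gt0 P_ge3 E_lo E_hi; nia.
pose w := absz (q%:Z - (p ^ (m - 1))%N%:Z - (P - 1) * X)%R.
have wE : w%:Z = q%:Z - (p ^ (m - 1))%N%:Z - (P - 1) * X.
  by rewrite /w gez0_abs // rE qE; move: X_gt0 P_ge3; nia.
have /andP[k_gt0 _] := k_lt.
have blkE : (#|blk k| * p.-1 = \sum_(a in coef) wcount a k)%N.
  apply: (@card_blocks k w) => // [a b h ca nz|].
    by rewrite -lez_nat wE hweight_ge.
  (* Both [k] and [w] lie within [(P - 1) * X] of [P ^+ 2 * (P - 1) * X], so the inequality follows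
     from [2 * P - 3 < P ^+ 2]. *)
  rewrite -ltz_nat !PoszM kE wE predpE -subzn // rE qE -/P.
  by move: X_gt0 P_ge3 E_hi; nia.
have [des cntE] := is_2design_blocks k.
exists k, #|through k 0 1|; split=> //; first by rewrite iE -kE.
have iEk : i = k%:R by rewrite iE -kE.
have p1_nz : p%:R - 1 != 0 :> rat.
  by rewrite subr_eq0 pnatr_eq1 gtn_eqF.
have q_nz : q%:R != 0 :> rat by rewrite pnatr_eq0 -lt0n expn_gt0 p_gt0.
have q1_nz : q%:R - 1 != 0 :> rat.
  by rewrite subr_eq0 pnatr_eq1 gtn_eqF // -cardF card_finRing_gt1.
have predR j : (0 < j)%N -> j.-1%:R = j%:R - 1 :> rat.
  by move=> j_gt0; rewrite -subn1 natrB.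
have B_nzR : B%:~R != 0 :> rat by rewrite intr_eq0.
have blkR : B%:~R * (#|blk k|%:R * (p%:R - 1)) = A%:~R :> rat.
  by rewrite -(count k k_lt kE) -blkE rmorphM /= -pmulrn natrM predR.
have cntR : #|through k 0 1|%:R * (q%:R * (q%:R - 1)) =
  #|blk k|%:R * (i * (i - 1)) :> rat.
  by rewrite iEk -!predR ?expn_gt0 ?p_gt0 // -!natrM cntE.
apply: (mulIf (mulf_neq0 B_nzR (mulf_neq0 p1_nz (mulf_neq0 q_nz q1_nz)))).
rewrite -lamE -blkR -[RHS]mulrA; have := cntR; move: (#|through k 0 1|%:R) => N.
move: (i * (i - 1)) (q%:R * (q%:R - 1)) => I Q e.
transitivity (B%:~R * (p%:R - 1) * (N * Q)); first by ring.
by rewrite e; ring.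
Qed.

End Designs.

(** * Sums over the leading coefficient and bounds on level sizes *)

Lemma coef_full : (l.*2 != m)%N -> coef = [set: F].
Proof. by move=> /negPf lm; rewrite /quad_coef lm. Qed.

Lemma sum_coef k :
  (\sum_(a in coef) wcount a k)%N%:Z =
  (wcount 0 k)%:Z + \sum_(a in coef | a != 0) (wcount a k)%:Z.
Proof.
rewrite (big_morph Posz PoszD (erefl _)) (bigD1 0) ?coef0 //=.
Qed.

Lemma card_coef_nz : (l.*2 != m)%N -> #|[pred a in coef | a != 0]| = q.-1.
Proof.
move=> lm; rewrite -cardF -(cardC1 (0 : F)); apply: eq_card => a.
by rewrite !inE coef_full // inE.
Qed.

(** Up to sign, the deviation is [(p - 1) * excess a] at level 0 and [excess a] at the other
    levels. *)
Lemma near_uniform_even :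
  (forall u : 'F_p, u != 0 -> exists2 v : F, v != 0 & v ^+ n = emb u) ->
  (forall a, a \in coef -> a != 0 -> `|excess a| <= (p ^ (m - 2))%N%:Z) -> near_uniform.
Proof.
move=> roots small a t ca a_nz; have := small a ca a_nz.
have p1 : 1 <= p%:Z - 1 by rewrite -predpE lez_nat; case: (p) p_gt1 => [|[]].
have [->|t_nz] := eqVneq t 0 => le_ex.
  rewrite level0_excess // opprD addrA subrr sub0r normrN normrM ger0_norm.
    by rewrite ler_pM2l //; apply: lt_le_trans p1.
  exact: le_trans p1.
rewrite level_const // level1_excess // opprB addrC subrK.
apply: le_trans le_ex _; rewrite -[leLHS]mul1r ler_wpM2r //.
Qed.

Lemma near_uniform_odd (s : int) :
  odd m -> (gcdn n q.-1 %| 2)%N -> (forall a, a != 0 -> #|radical a| = 1%N) ->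
  q%:Z = p%:Z * s ^+ 2 -> p%:Z * `|s| <= (p ^ (m - 2))%N%:Z -> near_uniform.
Proof.
move=> m_odd g_dv r1 qs le_s a t _ a_nz.
have p1 : 1 <= p%:Z - 1 by rewrite -predpE lez_nat; case: (p) p_gt1 => [|[]].
have [x [y [e [e2 xE yE fE]]]] := level_odd m_odd g_dv r1 a_nz.
have le_e : `|e| <= (p%:Z - 1) * (p ^ (m - 2))%N%:Z.
  have -> : `|e| = p%:Z * `|s|.
    have : e ^+ 2 = (p%:Z * s) ^+ 2 by rewrite e2 qs exprMn expr2; ring.
    by move/eqP; rewrite eqf_sqr => /orP[]/eqP ->; rewrite ?normrN normrM.
  by apply: le_trans le_s _; rewrite -[leLHS]mul1r ler_wpM2r.
(* Summing the indicator of a fourth value shows that only three level sizes occur. *)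
have : (\sum_t ((level a t != level a 0) && (level a t != x) && (level a t != y)) =
  0)%N.
  rewrite (fE (fun N => nat_of_bool ((N != level a 0%R) && (N != x) && (N != y))%N)).
  by rewrite !eqxx /= !andbF /= muln0.
move/eqP; rewrite sum_nat_eq0 => /forall_inP/(_ t isT).
rewrite eqb0 !negb_and !negbK -orbA => /or3P[] /eqP ->.
- rewrite -PoszM level0_odd // subrr normr0 mulr_ge0 //; exact: le_trans p1.
- by rewrite xE opprB addrC subrK.
- by rewrite yE opprD addrA subrr sub0r normrN.
Qed.

(** The multiplicities do not depend on [f]: taking [f] to be the identity determines them, and
    other choices then give word counts. *)
Lemma sum_two_values (I : pred F) (S : F -> int) (u v : int) :
  (forall a, I a -> S a = u \/ S a = v) ->
  exists c c' : nat, (c + c' = #|I|)%N /\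
    forall f : int -> int, \sum_(a | I a) f (S a) = c%:Z * f u + c'%:Z * f v.
Proof.
move=> Suv; exists #|[pred a | I a & S a == u]|, #|[pred a | I a & S a != u]|.
split=> [|f]; first by rewrite -(cardID [pred a | S a == u] I); congr (_ + _)%N;
  apply: eq_card => a; rewrite !inE //= andbC.
rewrite (bigID (fun a => S a == u)) /=; congr (_ + _).
  rewrite (eq_bigr (fun=> f u)) => [|a /andP[_ /eqP ->] //].
  by rewrite sumr_const -mulr_natl natz.
rewrite (eq_bigr (fun=> f v)) => [|a /andP[Ia Su]].
  by rewrite sumr_const -mulr_natl natz.
by case: (Suv a Ia) => [e|-> //]; rewrite e eqxx in Su.
Qed.

Lemma count_odd k (E s : int) :
  odd m -> (gcdn n q.-1 %| 2)%N -> (forall a, a != 0 -> #|radical a| = 1%N) ->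
  q%:Z = p%:Z * s ^+ 2 ->
  (0 < k < q)%N -> k%:Z = q%:Z - (p ^ (m - 1))%N%:Z + E ->
  2 * (\sum_(a in coef) wcount a k)%N%:Z =
  (q%:Z - 1) * (2 * p%:Z * (E == 0)%:Z
    + q%:Z * (2 * (E == 0)%:Z + (p%:Z - 1) * ((E == s)%:Z + (E == - s)%:Z))).
Proof.
move=> m_odd g_dv r1 qs k_lt kE; have lm : (l.*2 != m)%N.
  by apply: contraTneq m_odd => <-; rewrite odd_double.
have h2 : 2 * p.-1./2%:Z = p%:Z - 1.
  rewrite -predpE -[in RHS](odd_double_half p.-1).
  have -> : odd p.-1 = false by move: p_odd;
    rewrite -[p in odd p](prednK p_gt0) /= => /negPf.
  by rewrite add0n -mul2n PoszM.
rewrite sum_coef (wcount_0 k_lt kE).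
rewrite (eq_bigr (fun=> q%:Z * ((E == 0)%:Z + p.-1./2%:Z * ((E == s)%:Z
  + (E == - s)%:Z)))).
  rewrite sumr_const card_coef_nz // -[_ *+ q.-1]mulr_natl (natz q.-1) -[q.-1]subn1
    -subzn ?expn_gt0 ?p_gt0 //.
  by rewrite -h2; ring.
by move=> a /andP[_ a_nz]; apply: wcount_odd.
Qed.

(** * Word counts for forms with equidistributed nonzero values *)

Section EvenCount.

Hypothesis roots :
  forall u : 'F_p, u != 0 -> exists2 v : F, v != 0 & v ^+ n = emb u.

Lemma sum_excess_coef : (l.*2 != m)%N -> \sum_(a in coef | a != 0) excess a = 0.
Proof.
move=> lm; rewrite -[RHS](sum_excess roots); apply: eq_bigl => a.
by rewrite coef_full // inE.
Qed.

Lemma wcount_rank_full a k (E : int) :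
  #|radical a| = 1%N -> k%:Z = q%:Z - (p ^ (m - 1))%N%:Z + E ->
  (wcount a k)%:Z =
  q%:Z * ((p%:Z * E == - ((p%:Z - 1) * excess a))%:Z
    + (p%:Z - 1) * (p%:Z * E == excess a)%:Z).
Proof.
move=> r1 kE; have := wcount_even roots a kE.
by rewrite r1 mul1r subrr mul0r addr0.
Qed.

(** The excess is [s] or [- s], and since it sums to zero each sign occurs for half of the nonzero
    [a]. *)
Lemma count_even k (E s : int) :
  (l.*2 != m)%N -> s != 0 -> (forall a, a != 0 -> #|radical a| = 1%N) ->
  q%:Z = s ^+ 2 ->
  (0 < k < q)%N -> k%:Z = q%:Z - (p ^ (m - 1))%N%:Z + E ->
  2 * (\sum_(a in coef) wcount a k)%N%:Z =
  (q%:Z - 1) * (2 * p%:Z * (E == 0)%:Z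
    + q%:Z * ((p%:Z * E == - ((p%:Z - 1) * s))%:Z + (p%:Z * E == (p%:Z - 1) * s)%:Z
       + (p%:Z - 1) * ((p%:Z * E == s)%:Z + (p%:Z * E == - s)%:Z))).
Proof.
move=> lm s_nz r1 qs k_lt kE; rewrite sum_coef (wcount_0 k_lt kE).
pose f z : int := q%:Z * ((p%:Z * E == - ((p%:Z - 1) * z))%:Z
  + (p%:Z - 1) * (p%:Z * E == z)%:Z).
rewrite (eq_bigr (fun a => f (excess a))) => [|a /andP[_ a_nz]]; last first.
  by rewrite (wcount_rank_full _ kE) // r1.
have Sv a : (a \in coef) && (a != 0) -> excess a = s \/ excess a = - s.
  move=> /andP[_ a_nz]; have := excess_sqr roots a; rewrite r1 // mulr1 qs => /eqP.
  by rewrite eqf_sqr => /orP[]/eqP; [left | right].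
have [c [c' [cc fE]]] := sum_two_values Sv.
have := fE id; rewrite /= (sum_excess_coef lm) mulrN -mulrBl => /esym/eqP.
rewrite mulf_eq0 (negPf s_nz) orbF subr_eq0 eqz_nat => /eqP c'E.
have c2 : 2 * c%:Z = q%:Z - 1.
  move/(congr1 Posz): cc; rewrite (_ : #|_| = q.-1); last exact: card_coef_nz.
  by rewrite -c'E -subn1 -subzn ?expn_gt0 ?p_gt0 // PoszD => <-; ring.
rewrite fE -c'E /f mulrN opprK -c2; ring.
Qed.

(** If [c] and [c'] are the multiplicities of the two types, the zero sum gives [c = c' * D], so
    [(D + 1) * c' = q - 1]. The factor [(D + 1) * D ^+ 2] clears this quotient and the radical
    size. *)
Lemma count_degenerate k (E s u D : int) :
  (l.*2 != m)%N -> 0 < s -> 1 < D ->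
  (forall a, a != 0 -> (#|radical a| = 1%N /\ excess a = u * s) \/
                       (#|radical a|%:Z = D ^+ 2 /\ excess a = - (u * (s * D)))) ->
  u ^+ 2 = 1 ->
  (0 < k < q)%N -> k%:Z = q%:Z - (p ^ (m - 1))%N%:Z + E ->
  (D + 1) * D ^+ 2 * (\sum_(a in coef) wcount a k)%N%:Z =
  (q%:Z - 1) * ((D + 1) * D ^+ 2 * p%:Z * (E == 0)%:Z
    + q%:Z * (D ^+ 3 * ((p%:Z * E == - ((p%:Z - 1) * (u * s)))%:Z
                   + (p%:Z - 1) * (p%:Z * E == u * s)%:Z)
       + ((p%:Z * E == (p%:Z - 1) * (u * (s * D)))%:Z
            + (p%:Z - 1) * (p%:Z * E == - (u * (s * D)))%:Z)
       + (D ^+ 2 - 1) * (p%:Z * (E == 0)%:Z))).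
Proof.
move=> lm s_gt0 D_gt1 types u2 k_lt kE; rewrite sum_coef (wcount_0 k_lt kE).
have u_nz : u != 0 by apply: contra_eqN u2 => /eqP ->; rewrite expr0n eq_sym oner_eq0.
pose g z : int := (p%:Z * E == - ((p%:Z - 1) * z))%:Z + (p%:Z - 1) * (p%:Z * E == z)%:Z.
(* [f] is [D ^+ 2] times the word count; the radical size is recovered from the excess, whose two
   possible values differ. *)
pose f z : int := if z == u * s then D ^+ 2 * (q%:Z * g z)
                  else q%:Z * g z + (D ^+ 2 - 1) * (q%:Z * p%:Z * (E == 0)%:Z).
have uv : (- (u * (s * D)) == u * s) = false.
  rewrite -mulrN (inj_eq (mulfI u_nz)); apply/eqP => e.
  have : 0 < s * D by rewrite mulr_gt0 // (lt_trans _ D_gt1).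
  lia.
rewrite mulrDr mulr_sumr -[(D + 1) * D ^+ 2 * _]mulrA.
rewrite (eq_bigr (fun a => (D + 1) * f (excess a))) => [|a /andP[_ a_nz]]; last first.
  case: (types a a_nz) => -[ra ea].
    by rewrite (wcount_rank_full ra kE) /f ea eqxx -mulrA.
  have := wcount_even roots a kE; rewrite ra => e.
  by rewrite -(mulrA (D + 1) (D ^+ 2)) e /f ea uv.
rewrite -mulr_sumr.
have Sv a : (a \in coef) && (a != 0) -> excess a = u * s \/ excess a = - (u * (s * D)).
  by move=> /andP[_ a_nz]; case: (types a a_nz) => -[_ ->]; [left | right].
have [c [c' [cc fE]]] := sum_two_values Sv.
have := fE id; rewrite /= (sum_excess_coef lm) => /esym/eqP.
have -> : c%:Z * (u * s) + c'%:Z * - (u * (s * D)) =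
  (c%:Z - c'%:Z * D) * (u * s) by ring.
rewrite mulf_eq0 [u * s == 0]mulf_eq0 (negPf u_nz) (gt_eqF s_gt0) !orbF subr_eq0 =>
  /eqP cE.
have c2 : (D + 1) * c'%:Z = q%:Z - 1.
  move/(congr1 Posz): cc; rewrite (_ : #|_| = q.-1); last exact: card_coef_nz.
  by rewrite -subn1 -subzn ?expn_gt0 ?p_gt0 // PoszD cE => <-; ring.
rewrite fE cE /f eqxx uv /g mulrN opprK -c2.
ring.
Qed.

(** The excess is constant, so each of the [p ^ l - 1] nonzero coefficients contributes the same. *)
Lemma count_subfield k (E s : int) :
  (l.*2 = m)%N -> (forall a, a \in coef -> a != 0 -> excess a = - s) ->
  (0 < k < q)%N -> k%:Z = q%:Z - (p ^ (m - 1))%N%:Z + E ->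
  (\sum_(a in coef) wcount a k)%N%:Z =
  (q%:Z - 1) * p%:Z * (E == 0)%:Z
   + ((p ^ l)%N%:Z - 1) * (q%:Z * ((p%:Z * E == (p%:Z - 1) * s)%:Z
     + (p%:Z - 1) * (p%:Z * E == - s)%:Z)).
Proof.
move=> lm exc k_lt kE; have lmb : (l.*2 == m)%N by rewrite lm.
have l_gt0 : (0 < l)%N by case: (l) lm l_lt => //= <-.
rewrite sum_coef (wcount_0 k_lt kE); congr (_ + _).
rewrite (eq_bigr (fun=> q%:Z * ((p%:Z * E == (p%:Z - 1) * s)%:Z
  + (p%:Z - 1) * (p%:Z * E == - s)%:Z))).
  rewrite sumr_const -mulr_natl natz; congr (_ * _).
  have := @card_frob_fix l l_gt0; rewrite -{1}lm -muln2 dvdn_mulr // => /(_ isT).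
  rewrite (cardsD1 0) inE frob0 eqxx => e.
  rewrite -e PoszD addrC addKr; congr (Posz _); apply: eq_card => a.
  by rewrite [LHS]andbC coefP lmb !inE.
move=> a /andP[ca a_nz].
by rewrite (wcount_rank_full (radical_subfield lmb ca a_nz) kE) exc // mulrN opprK.
Qed.

End EvenCount.

(** Factor [D ^+ j - (-1) ^+ j] by [D - (-1)]. *)
Lemma sign_power_dvd (D : int) j : exists K : int, D ^+ j = (-1) ^+ j + (D + 1) * K.
Proof.
exists (\sum_(i < j) D ^+ (j.-1 - i) * (-1) ^+ i).
by apply/eqP; rewrite addrC -subr_eq subrXX opprK.
Qed.

(* excess a is +/- p^M or +/- p^(M+d); since it is 1 modulo p^d + 1, where
   p^M = (-1)^j, the sign is forced. *)
Lemma excess_degenerate d j a :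
  (0 < l)%N -> (d %| l)%N -> odd (l %/ d) -> gcdn (2 * l) m = (2 * d)%N ->
  m = (2 * (d * j))%N ->
  (forall u : 'F_p, u != 0 -> exists2 v : F, v != 0 & v ^+ n = emb u) ->
  a != 0 ->
  (#|radical a| = 1%N /\ excess a = (-1) ^+ j * (p ^ (d * j))%N%:Z) \/
  (#|radical a|%:Z = (p ^ d)%N%:Z ^+ 2 /\
   excess a = - ((-1) ^+ j * ((p ^ (d * j))%N%:Z * (p ^ d)%N%:Z))).
Proof.
move=> l_gt0 dv od gd mE roots a_nz.
have d_gt0 : (0 < d)%N.
  have : (0 < gcdn (2 * l) m)%N by rewrite gcdn_gt0 muln_gt0 l_gt0.
  by rewrite gd muln_gt0.
have gE := gcd_even_quot l_gt0 dv od gd.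
have /dvdzP[z zE] := excess_mod a; rewrite gE -addn1 PoszD in zE.
set D := (p ^ d)%N%:Z in zE *; have D_ge3 : 3 <= D.
  have p_ge3 : (3 <= p)%N by case: (p) p_gt1 p_odd => [|[|[]]].
  by rewrite lez_nat (leq_trans p_ge3) // -[X in (X <= _)%N]expn1 leq_exp2l.
have [K KE] := sign_power_dvd D j; set s := (p ^ (d * j))%N%:Z.
have sE : s = (-1) ^+ j + (D + 1) * K.
  by rewrite -KE /s /D expnM; elim: (j) => [//|i IH]; rewrite expnS PoszM IH exprS.
set u := (-1) ^+ j in sE *; have u2 : u * u = 1 by rewrite -expr2 sqrr_sign.
(* A wrong sign of the excess would make [D + 1], which is at least 4, divide 2. *)
have no_dv w : (D + 1) * w = -2 -> False.
  by move: D_ge3; have [w0|w0] := lerP 0 w; nia.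
have qE : q%:Z = s ^+ 2 by rewrite expr2 -PoszM -expnD addnn -mul2n -mE.
have uE : u = 1 \/ u = -1.
  by rewrite /u -signr_odd; case: odd; [right | left].
have := excess_sqr roots a; rewrite qE; move: (excess a) zE => ex zE.
case: (radical_even l_gt0 gd a_nz) => rE.
  rewrite rE mulr1 => /eqP; rewrite eqf_sqr => /orP[]/eqP exE; left; split=> //.
    case: uE => uE; first by rewrite uE mul1r.
    by case: (no_dv (z - K)); move: zE; rewrite exE sE uE; lia.
  case: uE => uE; last by rewrite uE mulN1r.
  by case: (no_dv (z + K)); move: zE; rewrite exE sE uE; lia.
have rE' : #|radical a|%:Z = D ^+ 2.
  by rewrite rE /D expr2 -PoszM -expnD addnn -mul2n.
rewrite rE' -exprMn => /eqP; rewrite eqf_sqr => /orP[]/eqP exE; right; split=> //.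
  case: uE => uE; last by rewrite uE mulN1r opprK.
  by case: (no_dv (z - K * D - 1)); move: zE; rewrite exE sE uE; lia.
case: uE => uE; first by rewrite uE mul1r.
by case: (no_dv (z + K * D - 1)); move: zE; rewrite exE sE uE; lia.
Qed.

(** The excess is [p ^ l] up to sign and is 1 modulo [p ^ l + 1], where [p ^ l] is -1. *)
Lemma excess_subfield a :
  (0 < l)%N -> (l.*2 = m)%N ->
  (forall u : 'F_p, u != 0 -> exists2 v : F, v != 0 & v ^+ n = emb u) ->
  a \in coef -> a != 0 -> excess a = - (p ^ l)%N%:Z.
Proof.
move=> l_gt0 lm roots ca a_nz; have lmb : (l.*2 == m)%N by rewrite lm.
have gE : gcdn n q.-1 = (p ^ l).+1.
  by apply: gcd_even_quot => //; rewrite ?divnn ?l_gt0 // -lm mul2n gcdnn.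
have /dvdzP[z] := excess_mod a; rewrite gE -addn1 PoszD.
have := excess_sqr roots a; rewrite (radical_subfield lmb ca a_nz) mulr1.
have -> : q%:Z = (p ^ l)%N%:Z ^+ 2 by rewrite expr2 -PoszM -expnD addnn lm.
have : 3 <= (p ^ l)%N%:Z.
  have p_ge3 : (3 <= p)%N by case: (p) p_gt1 p_odd => [|[|[]]].
  by rewrite lez_nat (leq_trans p_ge3) // -[X in (X <= _)%N]expn1 leq_exp2l.
move: (p ^ l)%N%:Z => D D_ge3 /eqP; rewrite eqf_sqr => /orP[]/eqP -> // zE.
by exfalso; move: zE D_ge3; have [z0|z0] := lerP z 0; nia.
Qed.

(** * The four cases *)

Local Notation design := (holds_2design p m l F).

Let P_ge3 : 3 <= p%:Z.
Proof. by rewrite lez_nat; case: (p) p_gt1 p_odd => [|[|[]]]. Qed.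

Let pR : p%:Z%:~R = p%:R :> rat.
Proof. by rewrite -pmulrn. Qed.

Let eq_indicator (x y : int) : x = y -> (x == y)%:Z = 1.
Proof. by move=> ->; rewrite eqxx. Qed.

Let neq_indicator (x y : int) : x <> y -> (x == y)%:Z = 0.
Proof. by move/eqP/negPf => ->. Qed.

(** Evaluates the indicators in a word count at a concrete deviation: coincidences are ring
    identities, and all other comparisons fail by size. *)
Ltac decide_indicators bound :=
  repeat match goal with |- context [Posz (nat_of_bool (@eq_op _ ?x ?y))] =>
    first
    [ rewrite (@eq_indicator x y); last by ring
    | rewrite (@neq_indicator x y);
        last by (move: bound P_ge3; move: (p%:Z); clear; nia) ]
  end.

(** Meant for [s] equal to [p] to the power [(m - 1) / 2]: the deviations are 0, [s] and [- s]. All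
    powers are written through [P] and [S], so that [ring] and [field] apply. *)
Lemma designs_odd (s : int) (S : rat) :
  (4 < m)%N -> odd m -> (gcdn n q.-1 %| 2)%N ->
  (forall a, a != 0 -> #|radical a| = 1%N) ->
  0 < s -> s%:~R = S -> q%:Z = p%:Z * s ^+ 2 -> (p ^ (m - 1))%N%:Z = s ^+ 2 ->
  p%:Z * s <= (p ^ (m - 2))%N%:Z -> s <= (p ^ (m - 3))%N%:Z ->
  let P : rat := p%:R in
  [/\ design (P * S ^+ 2 - S ^+ 2) ((P * S ^+ 2 - S ^+ 2 - 1) * (S ^+ 2 + 1)),
      design (P * S ^+ 2 - S ^+ 2 + S)
        (1 / 2 * S * (P * S - S + 1) * (P * S ^+ 2 - S ^+ 2 + S - 1))
    & design (P * S ^+ 2 - S ^+ 2 - S)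
        (1 / 2 * S * (P * S - S - 1) * (P * S ^+ 2 - S ^+ 2 - S - 1))].
Proof.
move=> m_gt4 m_odd g_dv r1 s_gt0 sR qE rE s_le1 s_le2 P.
have lt : near_uniform.
  by apply: (@near_uniform_odd s) => //; rewrite gtr0_norm.
have m_gt2 : (2 < m)%N by apply: leq_trans m_gt4.
have qR : q%:R = P * S ^+ 2 :> rat.
  by rewrite [LHS]pmulrn -[Posz _]/(q%:Z) qE rmorphM rmorphXn /= pR sR.
have count := @count_odd _ _ s m_odd g_dv r1 qE.
have bound (E : int) : `|E| <= s -> `|E| <= (p%:Z - 1) * (p ^ (m - 3))%N%:Z.
  move=> le_E; apply: le_trans le_E _; apply: le_trans s_le2 _.
  rewrite -[leLHS]mul1r ler_wpM2r //; move: P_ge3; lia.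
split.
- apply: (@holds_design m_gt2 lt 0 ((p%:Z * s ^+ 2 - 1) * (2 * p%:Z
  + p%:Z * s ^+ 2 * 2)) 2) => //.
  + by apply: bound; rewrite normr0 ltW.
  + by rewrite qE rE !(rmorphM, rmorphB, rmorphD, rmorphXn, rmorph0) /= pR sR addr0.
  + move=> k k_lt kE; rewrite (count _ _ k_lt kE) qE; decide_indicators s_gt0.
    by ring.
  rewrite qR !(rmorphM, rmorphB, rmorphD, rmorphXn, rmorph1, rmorph_nat) /= pR sR.
  by ring.
- apply: (@holds_design m_gt2 lt s ((p%:Z * s ^+ 2 - 1) * (p%:Z * s ^+ 2 * (p%:Z -
  1))) 2) => //.
  + by apply: bound; rewrite gtr0_norm.
  + by rewrite qE rE !(rmorphM, rmorphB, rmorphD, rmorphXn) /= pR sR.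
  + move=> k k_lt kE; rewrite (count _ _ k_lt kE) qE; decide_indicators s_gt0.
    by ring.
  rewrite qR !(rmorphM, rmorphB, rmorphD, rmorphXn, rmorph1, rmorph_nat) /= pR sR.
  by field.
- apply: (@holds_design m_gt2 lt (- s) ((p%:Z * s ^+ 2 - 1) * (p%:Z * s ^+ 2 * (p%:Z
  - 1))) 2) => //.
  + by apply: bound; rewrite normrN gtr0_norm.
  + by rewrite qE rE !(rmorphM, rmorphB, rmorphD, rmorphN, rmorphXn) /= pR sR.
  + move=> k k_lt kE; rewrite (count _ _ k_lt kE) qE; decide_indicators s_gt0.
    by ring.
  rewrite qR !(rmorphM, rmorphB, rmorphD, rmorphXn, rmorph1, rmorph_nat) /= pR sR.
  by field.
Qed.

Let p_nz : p%:Z != 0.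
Proof. by case: (p) p_gt1. Qed.

Let bound_scaled (c w : int) :
  `|c| * w <= (p%:Z - 1) * (p ^ (m - 3))%N%:Z -> 0 < w ->
  `|c * w| <= (p%:Z - 1) * (p ^ (m - 3))%N%:Z.
Proof. by move=> le_c w_gt0; rewrite normrM (gtr0_norm w_gt0). Qed.

Let indicator_scaled (w c x y : int) :
  w != 0 -> x = c * w -> forall c', y = c' * w -> (x == y) = (c == c').
Proof. by move=> w_nz -> c' ->; rewrite (inj_eq (mulIf w_nz)). Qed.

(** Here [w] stands for [p ^ (m / 2 - 1)]. The excess is [p * w] up to sign, so the deviations are
    [c * w] with [c] equal to 0, to 1 or [p - 1], or to their negatives. *)
Lemma designs_even (w : int) (W : rat) :
  (2 < m)%N -> (l.*2 != m)%N ->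
  (forall u : 'F_p, u != 0 -> exists2 v : F, v != 0 & v ^+ n = emb u) ->
  (forall a, a != 0 -> #|radical a| = 1%N) ->
  0 < w -> w%:~R = W -> q%:Z = (p%:Z * w) ^+ 2 -> (p ^ (m - 1))%N%:Z = p%:Z * w ^+ 2 ->
  p%:Z * w <= (p ^ (m - 2))%N%:Z -> w <= (p ^ (m - 3))%N%:Z ->
  let P : rat := p%:R in let R := P * W ^+ 2 in
  [/\ design (P * R - R) (P * R - R - 1),
      design (R * (P - 1) + W)
        (1 / 2 * W * (P ^+ 2 * W - P * W + 1) * (P * R - R + W - 1)),
      design (R * (P - 1) - W)
        (1 / 2 * W * (P ^+ 2 * W - P * W - 1) * (P * R - R - W - 1)),
      design (R * (P - 1) + W * (P - 1))
        (1 / 2 * W * (P * W + 1) * (P * R - R + P * W - W - 1))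
    & design (R * (P - 1) - W * (P - 1))
        (1 / 2 * W * (P * W - 1) * (P * R - R - P * W + W - 1))].
Proof.
move=> m_gt2 lm roots r1 w_gt0 wR qE rE w_le1 w_le2 P R.
have w_nz : w != 0 by rewrite gt_eqF.
have pw_nz : p%:Z * w != 0 by rewrite mulf_neq0.
have lt : near_uniform.
  apply: near_uniform_even => // a _ a_nz; have := excess_sqr roots a;
    rewrite r1 // mulr1 qE.
  move/eqP; rewrite eqf_sqr => /orP[]/eqP ->; rewrite ?normrN gtr0_norm //;
    by rewrite mulr_gt0 //; apply: lt_le_trans P_ge3.
have qR : q%:R = (P * W) ^+ 2 :> rat.
  by rewrite [LHS]pmulrn -[Posz _]/(q%:Z) qE rmorphXn rmorphM /= pR wR.
pose A (c : int) : int := ((p%:Z * w) ^+ 2 - 1) * (2 * p%:Z * (c == 0)%:Z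
  + (p%:Z * w) ^+ 2 * ((c == - (p%:Z - 1))%:Z + (c == p%:Z - 1)%:Z
      + (p%:Z - 1) * ((c == 1)%:Z + (c == - 1)%:Z))).
have designs (c : int) (i lam : rat) :
    `|c| <= p%:Z - 1 -> i = P * R - R + c%:~R * W ->
    (A c)%:~R * (i * (i - 1)) =
      lam * (2 * ((P - 1) * ((P * W) ^+ 2 * ((P * W) ^+ 2 - 1)))) ->
    design i lam.
  move=> le_c iE lamE; apply: (@holds_design m_gt2 lt (c * w) (A c) 2) => //.
  - by apply: bound_scaled => //; apply: ler_pM => //; apply: ltW.
  - by rewrite iE qE rE !(rmorphM, rmorphB, rmorphD, rmorphXn) /= pR wR /R; ring.
  - move=> k k_lt kE; rewrite (count_even roots lm pw_nz r1 qE k_lt kE) qE /A.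
    rewrite (@indicator_scaled w c _ _ w_nz erefl 0); last by rewrite mul0r.
    (* Dividing by [p * w] turns every comparison into one between [c] and a multiplier that
       involves [p] only. *)
    have e x := @indicator_scaled (p%:Z * w) c (p%:Z * (c * w)) x pw_nz (mulrCA _ _ _).
    rewrite (e _ (- (p%:Z - 1))); last by ring.
    rewrite (e _ (p%:Z - 1)) // (e _ 1); last by ring.
    by rewrite (e _ (- 1)) //; ring.
  - by rewrite qR lamE rmorph_nat.
have p1_ge0 : 0 <= p%:Z - 1 by move: P_ge3; lia.
split.
- apply: (designs 0); rewrite ?normr0 ?mul0r ?addr0 // /A /R; decide_indicators P_ge3.
  rewrite !(rmorphM, rmorphB, rmorphD, rmorphXn, rmorph1, rmorph0, rmorph_nat) /= pR wR.
  by ring.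
- apply: (designs 1); rewrite ?normr1 /R; first by move: P_ge3; lia.
    by rewrite rmorph1; ring.
  rewrite /A; decide_indicators P_ge3.
  rewrite !(rmorphM, rmorphB, rmorphD, rmorphXn, rmorph1, rmorph0, rmorph_nat) /= pR wR.
  by field.
- apply: (designs (- 1)); rewrite ?normrN ?normr1 /R; first by move: P_ge3; lia.
    by rewrite rmorphN rmorph1; ring.
  rewrite /A; decide_indicators P_ge3.
  rewrite !(rmorphM, rmorphB, rmorphD, rmorphXn, rmorph1, rmorph0, rmorph_nat) /= pR wR.
  by field.
- apply: (designs (p%:Z - 1)); rewrite ?ger0_norm // /R.
    by rewrite rmorphB rmorph1 /= pR; ring.
  rewrite /A; decide_indicators P_ge3.
  rewrite !(rmorphM, rmorphB, rmorphD, rmorphXn, rmorph1, rmorph0, rmorph_nat) /= pR wR.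
  by field.
- apply: (designs (- (p%:Z - 1))); rewrite ?normrN ?ger0_norm // /R.
    by rewrite rmorphN rmorphB rmorph1 /= pR; ring.
  rewrite /A; decide_indicators P_ge3.
  rewrite !(rmorphM, rmorphB, rmorphD, rmorphXn, rmorph1, rmorph0, rmorph_nat) /= pR wR.
  by field.
Qed.

(** The excess is always [- (p * w)], which leaves only the multipliers 0, [-1] and [p - 1]. *)
Lemma designs_subfield (w : int) (W : rat) :
  (2 < m)%N -> (l.*2 = m)%N ->
  (forall u : 'F_p, u != 0 -> exists2 v : F, v != 0 & v ^+ n = emb u) ->
  0 < w -> w%:~R = W -> (p ^ l)%N%:Z = p%:Z * w -> (p ^ (m - 1))%N%:Z = p%:Z * w ^+ 2 ->
  p%:Z * w <= (p ^ (m - 2))%N%:Z -> w <= (p ^ (m - 3))%N%:Z ->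
  let P : rat := p%:R in let R := P * W ^+ 2 in
  [/\ design (P * R - R) (P * R - R - 1),
      design (P * R - R - W)
        (W * (P ^+ 2 * W - P * W - 1) * (P * R - R - W - 1) / (P * W + 1))
    & design (P * R - R + P * W - W) (W * (P * R - R + P * W - W - 1))].
Proof.
move=> m_gt2 lm roots w_gt0 wR lE rE w_le1 w_le2 P R.
have l_gt0 : (0 < l)%N by case: (l) lm l_lt => //= <-.
have exc a ca a_nz := excess_subfield l_gt0 lm roots (a := a) ca a_nz.
have w_nz : w != 0 by rewrite gt_eqF.
have pw_nz : p%:Z * w != 0 by rewrite mulf_neq0.
have pw_gt0 : 0 < p%:Z * w by rewrite mulr_gt0 //; apply: lt_le_trans P_ge3.
have qE : q%:Z = (p%:Z * w) ^+ 2 by rewrite -lE expr2 -PoszM -expnD addnn lm.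
have lt : near_uniform.
  by apply: near_uniform_even => // a ca a_nz; rewrite exc // normrN lE gtr0_norm.
have qR : q%:R = (P * W) ^+ 2 :> rat.
  by rewrite [LHS]pmulrn -[Posz _]/(q%:Z) qE rmorphXn rmorphM /= pR wR.
have W_gt0 : 0 < P * W.
  by rewrite /P -wR -pR -rmorphM /= ltr0z.
have W1 : P * W + 1 != 0 by rewrite gt_eqF // addr_gt0.
pose A (c : int) : int := ((p%:Z * w) ^+ 2 - 1) * p%:Z * (c == 0)%:Z
  + (p%:Z * w - 1) * ((p%:Z * w) ^+ 2 * ((c == p%:Z - 1)%:Z
    + (p%:Z - 1) * (c == - 1)%:Z)).
have designs (c : int) (i lam : rat) :
    `|c| <= p%:Z - 1 -> i = P * R - R + c%:~R * W ->
    (A c)%:~R * (i * (i - 1)) = lam * ((P - 1) * ((P * W) ^+ 2 * ((P * W) ^+ 2 - 1))) ->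
    design i lam.
  move=> le_c iE lamE; apply: (@holds_design m_gt2 lt (c * w) (A c) 1) => //.
  - by apply: bound_scaled => //; apply: ler_pM => //; apply: ltW.
  - by rewrite iE qE rE !(rmorphM, rmorphB, rmorphD, rmorphXn) /= pR wR /R; ring.
  - move=> k k_lt kE; rewrite mul1r (count_subfield (s := p%:Z * w) roots lm _ k_lt kE).
      rewrite qE lE /A.
      rewrite (@indicator_scaled w c _ _ w_nz erefl 0); last by rewrite mul0r.
      have e x := @indicator_scaled (p%:Z * w) c (p%:Z * (c * w)) x pw_nz (mulrCA _ _
        _).
      by rewrite (e _ (p%:Z - 1)) // (e _ (- 1)) //; ring.
    by move=> a ca a_nz; rewrite exc // lE.
  - by rewrite qR lamE rmorph1 mul1r.
have p1_ge0 : 0 <= p%:Z - 1 by move: P_ge3; lia.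
split.
- apply: (designs 0); rewrite ?normr0 ?mul0r ?addr0 // /A /R; decide_indicators P_ge3.
  rewrite !(rmorphM, rmorphB, rmorphD, rmorphXn, rmorph1, rmorph0, rmorph_nat) /= pR wR.
  by ring.
- apply: (designs (- 1)); rewrite ?normrN ?normr1 /R; first by move: P_ge3; lia.
    by rewrite rmorphN rmorph1; ring.
  rewrite /A; decide_indicators P_ge3.
  rewrite !(rmorphM, rmorphB, rmorphD, rmorphXn, rmorph1, rmorph0, rmorph_nat) /= pR wR.
  by field.
- apply: (designs (p%:Z - 1)); rewrite ?ger0_norm // /R.
    by rewrite rmorphB rmorph1 /= pR; ring.
  rewrite /A; decide_indicators P_ge3.
  rewrite !(rmorphM, rmorphB, rmorphD, rmorphXn, rmorph1, rmorph0, rmorph_nat) /= pR wR.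
  by field.
Qed.

(** With [D = p ^ d] and [t * D = p ^ (m / 2 - 1)], the deviations are [c * u * t * D]. Forms with
    trivial radical give [c = 1] and [- (p - 1)], the others [(p - 1) * D] and [- D]; balanced words
    give 0. *)
Lemma designs_degenerate (t D u : int) (T Dr eps : rat) :
  (2 < m)%N -> (l.*2 != m)%N ->
  (forall u : 'F_p, u != 0 -> exists2 v : F, v != 0 & v ^+ n = emb u) ->
  0 < t -> p%:Z <= D -> u = 1 \/ u = - 1 ->
  (forall a, a != 0 ->
     (#|radical a| = 1%N /\ excess a = u * (p%:Z * (t * D))) \/
     (#|radical a|%:Z = D ^+ 2 /\ excess a = - (u * (p%:Z * (t * D) * D)))) ->
  t%:~R = T -> D%:~R = Dr -> u%:~R = eps ->
  q%:Z = (p%:Z * (t * D)) ^+ 2 -> (p ^ (m - 1))%N%:Z = p%:Z * (t * D) ^+ 2 ->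
  p%:Z * (t * D) * D <= (p ^ (m - 2))%N%:Z -> t * D * D <= (p ^ (m - 3))%N%:Z ->
  let P : rat := p%:R in let W := T * Dr in let R := P * W ^+ 2 in
  [/\ design (P * R - R)
        ((P * R - R - 1) * (P ^+ 2 * T ^+ 2 * Dr - P ^+ 2 * T ^+ 2 + 1)),
      design (R * (P - 1) + eps * W)
        (W * Dr * (P ^+ 2 * W - P * W + eps) * (P * R - R + eps * W - 1) / (Dr + 1)),
      design (R * (P - 1) - eps * W * (P - 1))
        (W * Dr * (P * W - eps) * (P * R - R - eps * (P * W) + eps * W - 1) / (Dr + 1)),
      design (R * (P - 1) + eps * (W * Dr) * (P - 1))
        (T * (P * T + eps)
         * (P * R - R + eps * (P * W * Dr) - eps * (W * Dr) - 1) / (Dr + 1))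
    & design (R * (P - 1) - eps * (W * Dr))
        (T * (P ^+ 2 * T - P * T - eps) * (P * R - R - eps * (W * Dr) - 1) / (Dr + 1))].
Proof.
move=> m_gt2 lm roots t_gt0 D_ge uE types tR DR uR qE rE w_le1 w_le2 P W R.
have p_gt0' : 0 < p%:Z := lt_le_trans (isT : 0 < 3 :> int) P_ge3.
have D_gt0 : 0 < D := lt_le_trans p_gt0' D_ge.
have D_gt1 : 1 < D by move: D_ge P_ge3; lia.
have D1_nz : D + 1 != 0 by rewrite gt_eqF // addr_gt0.
have B_nz : (D + 1) * D ^+ 2 != 0 by rewrite mulf_neq0 // expf_neq0 // gt_eqF.
have Dr1_nz : Dr + 1 != 0 by rewrite -DR gt_eqF // addr_gt0 // ltr0z.
have Dr_nz : Dr != 0 by rewrite -DR intr_eq0 gt_eqF.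
pose w := t * D; have w_gt0 : 0 < w by rewrite mulr_gt0.
have wR : w%:~R = W by rewrite rmorphM /= tR DR.
have w_nz : w != 0 by rewrite gt_eqF.
have u2 : u * u = 1 by case: uE => ->.
have u_nz : u != 0 by case: uE => ->.
have uw_nz : u * w != 0 by rewrite mulf_neq0.
have puw_nz : p%:Z * (u * w) != 0 by rewrite mulf_neq0.
have pw_gt0 : 0 < p%:Z * w by rewrite mulr_gt0.
have norm_u : `|u| = 1 by case: uE => ->.
have lt : near_uniform.
  apply: near_uniform_even => // a _ a_nz; case: (types a a_nz) => -[_ ->].
    rewrite normrM norm_u mul1r gtr0_norm //; apply: le_trans w_le1.
    by rewrite -[leLHS]mulr1 ler_pM2l // ltW.
  by rewrite normrN normrM norm_u mul1r gtr0_norm // mulr_gt0.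
have qR : q%:R = (P * W) ^+ 2 :> rat.
  by rewrite [LHS]pmulrn -[Posz _]/(q%:Z) qE -/w rmorphXn rmorphM /= pR wR.
pose A (c : int) : int := ((p%:Z * w) ^+ 2 - 1) *
  ((D + 1) * D ^+ 2 * p%:Z * (c == 0)%:Z
   + (p%:Z * w) ^+ 2 * (D ^+ 3 * ((c == - (p%:Z - 1))%:Z + (p%:Z - 1) * (c == 1)%:Z)
     + ((c == (p%:Z - 1) * D)%:Z + (p%:Z - 1) * (c == - D)%:Z)
     + (D ^+ 2 - 1) * (p%:Z * (c == 0)%:Z))).
have designs (c : int) (i lam : rat) :
    `|c| <= (p%:Z - 1) * D -> i = P * R - R + eps * c%:~R * W ->
    (A c)%:~R * (i * (i - 1))
      = lam * ((Dr + 1) * Dr ^+ 2 * ((P - 1) * ((P * W) ^+ 2 * ((P * W) ^+ 2 - 1)))) ->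
    design i lam.
  move=> le_c iE lamE.
  apply: (@holds_design m_gt2 lt (c * (u * w)) (A c) ((D + 1) * D ^+ 2)) => //.
  - rewrite mulrA; apply: bound_scaled => //; rewrite normrM norm_u mulr1.
    apply: (le_trans (y := (p%:Z - 1) * D * w)); first by rewrite ler_pM2r.
    by rewrite -mulrA [D * w]mulrC ler_wpM2l //; move: P_ge3; lia.
  - rewrite iE qE rE -/w !(rmorphM, rmorphB, rmorphD, rmorphXn) /= pR uR.
    by rewrite -[t%:~R * D%:~R]/(_ * _) tR DR -/W /R; ring.
  - move=> k k_lt kE.
    rewrite (count_degenerate roots lm pw_gt0 D_gt1 types _ k_lt kE) ?expr2 // -expr2
      qE -/w /A.
    rewrite (@indicator_scaled (u * w) c _ _ uw_nz erefl 0); last by rewrite mul0r.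
    have e x := @indicator_scaled (p%:Z * (u * w)) c (p%:Z * (c * (u * w))) x puw_nz
      (mulrCA _ _ _).
    rewrite (e _ (- (p%:Z - 1))); last by ring.
    rewrite (e _ 1); last by ring.
    rewrite (e _ ((p%:Z - 1) * D)); last by ring.
    by rewrite (e _ (- D)) //; ring.
  - by rewrite qR lamE !(rmorphM, rmorphD, rmorph1, rmorphXn) /= DR.
have p1_ge0 : 0 <= p%:Z - 1 by move: P_ge3; lia.
have le1 : 1 <= (p%:Z - 1) * D by move: P_ge3 D_ge; move: (p%:Z); clear; nia.
have le2 : p%:Z - 1 <= (p%:Z - 1) * D by move: P_ge3 D_ge; move: (p%:Z); clear; nia.
have le3 : D <= (p%:Z - 1) * D by move: P_ge3 D_ge; move: (p%:Z); clear; nia.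
split.
- apply: (designs 0); rewrite ?normr0 ?mulr0 ?mul0r ?addr0 //;
  first exact: le_trans le1.
  rewrite /A; decide_indicators D_ge.
  rewrite !(rmorphM, rmorphB, rmorphD, rmorphXn, rmorph1, rmorph0, rmorph_nat) /= pR
    tR DR /R /W.
  by ring.
- apply: (designs 1); rewrite ?normr1 //; first by rewrite rmorph1 /R; ring.
  rewrite /A; decide_indicators D_ge.
  rewrite !(rmorphM, rmorphB, rmorphD, rmorphXn, rmorph1, rmorph0, rmorph_nat) /= pR
    tR DR /R /W.
  by field.
- apply: (designs (- (p%:Z - 1))); rewrite ?normrN ?ger0_norm //.
    by rewrite rmorphN rmorphB rmorph1 /= pR /R; ring.
  rewrite /A; decide_indicators D_ge.
  rewrite !(rmorphM, rmorphB, rmorphD, rmorphXn, rmorph1, rmorph0, rmorph_nat) /= pR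
    tR DR /R /W.
  by field.
- apply: (designs ((p%:Z - 1) * D)); rewrite ?ger0_norm //; try exact: le_trans le1.
    by rewrite rmorphM rmorphB rmorph1 /= pR DR /R; ring.
  rewrite /A; decide_indicators D_ge.
  rewrite !(rmorphM, rmorphB, rmorphD, rmorphXn, rmorph1, rmorph0, rmorph_nat) /= pR
    tR DR /R /W.
  by field.
- apply: (designs (- D)); rewrite ?normrN ?(gtr0_norm D_gt0) //.
    by rewrite rmorphN /= DR /R; ring.
  rewrite /A; decide_indicators D_ge.
  rewrite !(rmorphM, rmorphB, rmorphD, rmorphXn, rmorph1, rmorph0, rmorph_nat) /= pR
    tR DR /R /W.
  by field.
Qed.

End FiniteField.

(** * Arithmetic of [m], [l] and [d], and substitution of the prime powers *)

Theorem theorem5 (p m l d : nat) (F : finFieldType)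
    (p_pr : prime p) (p_odd : odd p)
    (m_ge2 : (2 <= m)%N) (l_ge1 : (1 <= l)%N) (l_le : (l <= m - 1)%N)
    (d_def : d = gcdn m l) (d_gt1 : (1 < d)%N)
    (cardF : #|F| = (p ^ m)%N) :
  let P : rat := p%:R in
  let eps : rat := (-1) ^+ (m %/ (2 * d)) in
  let design := holds_2design p m l F in
  [/\
   (* (1) *)
   odd m -> odd (m %/ d) ->
   [/\ design (P ^+ m - P ^+ (m - 1))
              ((P ^+ m - P ^+ (m - 1) - 1) * (P ^+ (m - 1) + 1)),
       design (P ^+ m - P ^+ (m - 1) + P ^+ ((m - 1) %/ 2))
              (1 / 2 * P ^+ ((m - 1) %/ 2)
               * (P ^+ ((m + 1) %/ 2) - P ^+ ((m - 1) %/ 2) + 1)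
               * (P ^+ m - P ^+ (m - 1) + P ^+ ((m - 1) %/ 2) - 1))
     & design (P ^+ m - P ^+ (m - 1) - P ^+ ((m - 1) %/ 2))
              (1 / 2 * P ^+ ((m - 1) %/ 2)
               * (P ^+ ((m + 1) %/ 2) - P ^+ ((m - 1) %/ 2) - 1)
               * (P ^+ m - P ^+ (m - 1) - P ^+ ((m - 1) %/ 2) - 1))],
   (* (2) *)
   ~~ odd m -> odd (m %/ d) ->
   [/\ design (P ^+ m - P ^+ (m - 1))
              (P ^+ m - P ^+ (m - 1) - 1),
       design (P ^+ (m - 1) * (P - 1) + P ^+ (m %/ 2 - 1))
              (1 / 2 * P ^+ (m %/ 2 - 1)
               * (P ^+ (m %/ 2 + 1) - P ^+ (m %/ 2) + 1)
               * (P ^+ m - P ^+ (m - 1) + P ^+ (m %/ 2 - 1) - 1)),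
       design (P ^+ (m - 1) * (P - 1) - P ^+ (m %/ 2 - 1))
              (1 / 2 * P ^+ (m %/ 2 - 1)
               * (P ^+ (m %/ 2 + 1) - P ^+ (m %/ 2) - 1)
               * (P ^+ m - P ^+ (m - 1) - P ^+ (m %/ 2 - 1) - 1)),
       design (P ^+ (m - 1) * (P - 1) + P ^+ (m %/ 2 - 1) * (P - 1))
              (1 / 2 * P ^+ (m %/ 2 - 1)
               * (P ^+ (m %/ 2) + 1)
               * (P ^+ m - P ^+ (m - 1) + P ^+ (m %/ 2) - P ^+ (m %/ 2 - 1) - 1))
     & design (P ^+ (m - 1) * (P - 1) - P ^+ (m %/ 2 - 1) * (P - 1))
              (1 / 2 * P ^+ (m %/ 2 - 1)
               * (P ^+ (m %/ 2) - 1)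
               * (P ^+ m - P ^+ (m - 1) - P ^+ (m %/ 2) + P ^+ (m %/ 2 - 1) - 1))],
   (* (3) *)
   (4 <= m %/ d)%N -> ~~ odd (m %/ d) ->
   [/\ design (P ^+ m - P ^+ (m - 1))
              ((P ^+ m - P ^+ (m - 1) - 1)
               * (P ^+ (m - d) - P ^+ (m - 2 * d) + 1)),
       design (P ^+ (m - 1) * (P - 1) + eps * P ^+ (m %/ 2 - 1))
              (P ^+ (m %/ 2 + d - 1)
               * (P ^+ (m %/ 2 + 1) - P ^+ (m %/ 2) + eps)
               * (P ^+ m - P ^+ (m - 1) + eps * P ^+ (m %/ 2 - 1) - 1)
               / (P ^+ d + 1)),
       design (P ^+ (m - 1) * (P - 1) - eps * P ^+ (m %/ 2 - 1) * (P - 1))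
              (P ^+ (m %/ 2 + d - 1)
               * (P ^+ (m %/ 2) - eps)
               * (P ^+ m - P ^+ (m - 1)
                  - eps * P ^+ (m %/ 2) + eps * P ^+ (m %/ 2 - 1) - 1)
               / (P ^+ d + 1)),
       design (P ^+ (m - 1) * (P - 1) + eps * P ^+ (m %/ 2 + d - 1) * (P - 1))
              (P ^+ (m %/ 2 - d - 1)
               * (P ^+ (m %/ 2 - d) + eps)
               * (P ^+ m - P ^+ (m - 1)
                  + eps * P ^+ (m %/ 2 + d) - eps * P ^+ (m %/ 2 + d - 1) - 1)
               / (P ^+ d + 1))
     & design (P ^+ (m - 1) * (P - 1) - eps * P ^+ (m %/ 2 + d - 1))
              (P ^+ (m %/ 2 - d - 1)
               * (P ^+ (m %/ 2 - d + 1) - P ^+ (m %/ 2 - d) - eps)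
               * (P ^+ m - P ^+ (m - 1) - eps * P ^+ (m %/ 2 + d - 1) - 1)
               / (P ^+ d + 1))]
   (* (4) *)
   & m = (2 * d)%N ->
   [/\ design (P ^+ m - P ^+ (m - 1))
              (P ^+ m - P ^+ (m - 1) - 1),
       design (P ^+ m - P ^+ (m - 1) - P ^+ (m %/ 2 - 1))
              (P ^+ (m %/ 2 - 1)
               * (P ^+ (m %/ 2 + 1) - P ^+ (m %/ 2) - 1)
               * (P ^+ m - P ^+ (m - 1) - P ^+ (m %/ 2 - 1) - 1)
               / (P ^+ (m %/ 2) + 1))
     & design (P ^+ m - P ^+ (m - 1) + P ^+ (m %/ 2) - P ^+ (m %/ 2 - 1))
              (P ^+ (m %/ 2 - 1)
               * (P ^+ m - P ^+ (m - 1) + P ^+ (m %/ 2) - P ^+ (m %/ 2 - 1) - 1))]].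
Proof.
move=> P eps design.
have p_gt1 := prime_gt1 p_pr.
have l_lt : (l < m)%N by clear - m_ge2 l_le; lia.
have d_gt0 : (0 < d)%N by apply: ltnW.
have d_m : (d %| m)%N by rewrite d_def dvdn_gcdl.
have d_l : (d %| l)%N by rewrite d_def dvdn_gcdr.
have mE : (m = m %/ d * d)%N by rewrite divnK.
have cop : coprime (m %/ d) (l %/ d).
  rewrite /coprime -(eqn_pmul2r d_gt0) muln_gcdl !divnK // mul1n.
  by rewrite [X in _ == X]d_def.
(* As [m / d] and [l / d] are coprime, the parity of [m / d] alone decides between [d] and
   [2 * d]. *)
have gdE : gcdn (2 * l) m = (gcdn 2 (m %/ d) * d)%N.
  rewrite muln_gcdl -mE -[in LHS](divnK d_l) -[in LHS](divnK d_m) mulnA -muln_gcdl.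
  by rewrite gcdnC Gauss_gcdl // [in LHS]gcdnC muln_gcdl -mE.
have g_odd : odd (m %/ d) -> gcdn (2 * l) m = d.
  by move=> o; rewrite gdE (eqP (_ : coprime 2 _)) ?mul1n ?coprime2n.
(* The quotient [m / d] is not 1, since [d] divides [l] and [l < m]. *)
have m_ge3 : odd (m %/ d) -> (3 * d <= m)%N.
  move=> o; rewrite [leqRHS]mE leq_pmul2r //; case: (m %/ d)%N o mE => [|[|[|k]]] //=.
  by rewrite mul1n => _ md; have := dvdn_leq l_ge1 d_l; rewrite -md leqNgt l_lt.
have lm_d : (l.*2 == m)%N -> m = (2 * d)%N.
  by move=> /eqP lm; rewrite d_def -lm -muln2 gcdnC gcdnMr mulnC.
have lm_odd : odd (m %/ d) -> (l.*2 != m)%N.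
  by move=> o; apply: contraTneq o => /eqP/lm_d ->; rewrite mulnK.
have leE i j : ((p ^ i)%N%:Z <= (p ^ j)%N%:Z) = (i <= j)%N.
  by rewrite lez_nat leq_exp2l.
have pow_gt0 i : 0 < (p ^ i)%N%:Z by rewrite ltz_nat expn_gt0 ltnW.
have powR i : (p ^ i)%N%:Z%:~R = P ^+ i by rewrite -pmulrn natrX.
have pM i : p%:Z * (p ^ i)%N%:Z = (p ^ i.+1)%N%:Z by rewrite -PoszM -expnS.
have sqrM i : (p ^ i)%N%:Z ^+ 2 = (p ^ (2 * i))%N%:Z.
  by rewrite expr2 -PoszM -expnD addnn mul2n.
have r1 o a := radical_odd p_pr cardF p_odd l_lt l_ge1 d_l (g_odd o) (a := a).
have g2 o := gcd_odd_quot p_pr l_ge1 d_l (g_odd o).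
split.
- move=> m_odd o; have m3 := m_ge3 o; have [j mj] : exists j, m = (2 * j).+1.
    by exists m./2; rewrite mul2n -[LHS]odd_double_half m_odd.
  have qE : (p ^ m)%N%:Z = p%:Z * (p ^ j)%N%:Z ^+ 2 by rewrite sqrM pM -mj.
  have rE : (p ^ (m - 1))%N%:Z = (p ^ j)%N%:Z ^+ 2.
    by rewrite sqrM; congr (Posz (_ ^ _)); (clear - m3 mj d_gt1; lia).
  have le1 : p%:Z * (p ^ j)%N%:Z <= (p ^ (m - 2))%N%:Z by rewrite pM leE;
    (clear - m3 mj d_gt1; lia).
  have le2 : (p ^ j)%N%:Z <= (p ^ (m - 3))%N%:Z by rewrite leE; (clear - m3 mj d_gt1;
    lia).
  have m_gt4 : (4 < m)%N by (clear - m3 mj d_gt1; lia).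
  have [h1 h2 h3] := designs_odd p_pr cardF p_odd l_lt m_gt4 m_odd (g2 o) (r1 o)
    (pow_gt0 j) (powR j) qE rE le1 le2.
  have Pm : P ^+ m = P * (P ^+ j) ^+ 2 by rewrite -exprM -exprS; congr (_ ^+ _);
    (clear - m3 mj d_gt1; lia).
  have Pm1 : P ^+ (m - 1) = (P ^+ j) ^+ 2 by rewrite -exprM; congr (_ ^+ _);
    (clear - m3 mj d_gt1; lia).
  have -> : ((m - 1) %/ 2 = j)%N by (clear - m3 mj d_gt1; lia).
  have -> : ((m + 1) %/ 2 = j.+1)%N by (clear - m3 mj d_gt1; lia).
  by rewrite (exprS P j) Pm Pm1; split.
- move=> m_even o; have m3 := m_ge3 o; have [M mM] : exists M, m = (2 * M)%N.
    by exists m./2; rewrite mul2n -[LHS]odd_double_half (negPf m_even).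
  have roots (u : 'F_p) : u != 0 -> exists2 v : F, v != 0 & v ^+ (p ^ l).+1 = emb F u.
    (* The gcd divides 2, and [p ^ M + 1] is even. *)
    apply: (ex_root_Fp p_pr cardF (e := M)); first by rewrite -mM.
    by apply: dvdn_trans (g2 o) _; rewrite dvdn2 /= oddX p_odd orbT.
  have MS : (M = (M - 1).+1)%N by (clear - m3 mM d_gt1; lia).
  have qE : (p ^ m)%N%:Z = (p%:Z * (p ^ (M - 1))%N%:Z) ^+ 2 by rewrite pM sqrM -MS -mM.
  have rE : (p ^ (m - 1))%N%:Z = p%:Z * (p ^ (M - 1))%N%:Z ^+ 2.
    by rewrite sqrM pM; congr (Posz (_ ^ _)); (clear - m3 mM d_gt1; lia).
  have le1 : p%:Z * (p ^ (M - 1))%N%:Z <= (p ^ (m - 2))%N%:Z by rewrite pM leE;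
    (clear - m3 mM d_gt1; lia).
  have le2 : (p ^ (M - 1))%N%:Z <= (p ^ (m - 3))%N%:Z by rewrite leE;
    (clear - m3 mM d_gt1; lia).
  have m_gt2 : (2 < m)%N by (clear - m3 mM d_gt1; lia).
  have [h1 h2 h3 h4 h5] := designs_even p_pr cardF p_odd l_lt m_gt2 (lm_odd o) roots
    (r1 o)
    (pow_gt0 (M - 1)%N) (powR (M - 1)%N) qE rE le1 le2.
  set W := P ^+ (M - 1) in h1 h2 h3 h4 h5 *.
  have Pm1 : P ^+ (m - 1) = P * W ^+ 2 by rewrite -exprM -exprS; congr (_ ^+ _);
    (clear - m3 mM d_gt1; lia).
  have Pm : P ^+ m = P * (P * W ^+ 2) by rewrite -Pm1 -exprS; congr (_ ^+ _);
    (clear - m3 mM d_gt1; lia).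
  have -> : (m %/ 2 = M)%N by (clear - m3 mM d_gt1; lia).
  have PM : P ^+ M = P * W by rewrite -exprS -MS.
  have PM1 : P ^+ (M + 1) = P ^+ 2 * W by rewrite exprD PM expr1; ring.
  rewrite Pm Pm1 PM1 PM.
  by split.
- move=> m_ge4 m_even.
  have j_m : (m = 2 * (d * (m %/ (2 * d))))%N.
    by rewrite mulnA mulnC divnK // [X in (_ %| X)%N]mE dvdn_pmul2r // dvdn2 m_even.
  rewrite {}/eps; move: (m %/ (2 * d))%N j_m => j j_m; pose eps : rat := (-1) ^+ j.
  rewrite -/eps.
  have m4 : (4 * d <= m)%N by rewrite [leqRHS]mE leq_pmul2r.
  have gd2 : gcdn (2 * l) m = (2 * d)%N.
    by rewrite gdE (gcdn_idPl _) // dvdn2 m_even.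
  (* Otherwise 2 would divide both of the coprime quotients. *)
  have odd_l : odd (l %/ d).
    apply/negPn/negP => l_even.
    have : (2 %| gcdn (m %/ d) (l %/ d))%N by rewrite dvdn_gcd !dvdn2 m_even l_even.
    by rewrite (eqP cop).
  have lm : (l.*2 != m)%N by apply/negP => /lm_d; clear - m4 d_gt1; lia.
  have gE := gcd_even_quot p_pr l_ge1 d_l odd_l gd2.
  have roots (u : 'F_p) : u != 0 -> exists2 v : F, v != 0 & v ^+ (p ^ l).+1 = emb F u.
    apply: (ex_root_Fp p_pr cardF (e := d)); last by rewrite gE.
    by rewrite j_m mulnA dvdn_mulr.
  have types (a : F) : a != 0 -> _ :=
    excess_degenerate p_pr cardF p_odd l_lt l_ge1 d_l odd_l gd2 j_m roots (a := a).
  move: (d * j)%N j_m types => M mM types.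
  (* The truncated subtractions are exact, because [2 * d <= M] and [1 < d]. *)
  have Mt : M = (M - d - 1 + d).+1 by (clear - m4 mM d_gt1; lia).
  rewrite [X in (p ^ X)%N]Mt expnS expnD !PoszM in types.
  have uE : (-1) ^+ j = 1 :> int \/ (-1) ^+ j = - 1 :> int.
    by rewrite -signr_odd; case: (odd j); [right | left].
  have uR : ((-1) ^+ j)%:~R = eps by rewrite rmorphXn rmorphN rmorph1.
  have powD i k : (p ^ i)%N%:Z * (p ^ k)%N%:Z = (p ^ (i + k))%N%:Z.
    by rewrite -PoszM -expnD.
  set t := (p ^ (M - d - 1))%N%:Z in types; set D := (p ^ d)%N%:Z in types.
  have m_gt2 : (2 < m)%N by (clear - m4 mM d_gt1; lia).
  have D_ge : p%:Z <= D by rewrite -[p in p%:Z <= _]expn1 leE.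
  have qE : (p ^ m)%N%:Z = (p%:Z * (t * D)) ^+ 2.
    by rewrite powD pM sqrM; congr (Posz (_ ^ _)); (clear - m4 mM d_gt1; lia).
  have rE : (p ^ (m - 1))%N%:Z = p%:Z * (t * D) ^+ 2.
    by rewrite powD sqrM pM; congr (Posz (_ ^ _)); (clear - m4 mM d_gt1; lia).
  have le1 : p%:Z * (t * D) * D <= (p ^ (m - 2))%N%:Z by rewrite powD pM powD leE;
    (clear - m4 mM d_gt1; lia).
  have le2 : t * D * D <= (p ^ (m - 3))%N%:Z by rewrite !powD leE;
    (clear - m4 mM d_gt1; lia).
  have [h1 h2 h3 h4 h5] := designs_degenerate p_pr cardF p_odd l_lt m_gt2 lm roots
    (pow_gt0 (M - d - 1)%N) D_ge uE types (powR _) (powR _) uR qE rE le1 le2.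
  clear t D types D_ge qE rE le1 le2.
  set T := P ^+ (M - d - 1) in h1 h2 h3 h4 h5 *; set D := P ^+ d in h1 h2 h3 h4 h5 *.
  have PM1 : P ^+ (M - 1) = T * D by rewrite -exprD; congr (_ ^+ _);
    (clear - m4 mM d_gt1; lia).
  have Pm1 : P ^+ (m - 1) = P * (T * D) ^+ 2.
    by rewrite -PM1 -exprM -exprS; congr (_ ^+ _); (clear - m4 mM d_gt1; lia).
  have Pm : P ^+ m = P * (P * (T * D) ^+ 2) by rewrite -Pm1 -exprS; congr (_ ^+ _);
    (clear - m4 mM d_gt1; lia).
  have -> : (m %/ 2 = M)%N by (clear - m4 mM d_gt1; lia).
  have PM : P ^+ M = P * (T * D) by rewrite -PM1 -exprS; congr (_ ^+ _);
    (clear - m4 mM d_gt1; lia).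
  have PMs : P ^+ (M + 1) = P ^+ 2 * (T * D) by rewrite exprD PM expr1; ring.
  have PMd : P ^+ (M + d) = P * (T * D) * D by rewrite exprD PM.
  have PMd1 : P ^+ (M + d - 1) = T * D * D.
    by rewrite -PM1 -exprD; congr (_ ^+ _); (clear - m4 mM d_gt1; lia).
  have PMmd : P ^+ (M - d) = P * T by rewrite -exprS; congr (_ ^+ _);
    (clear - m4 mM d_gt1; lia).
  have PMmd1 : P ^+ (M - d + 1) = P ^+ 2 * T by rewrite exprD PMmd expr1; ring.
  have Pmmd : P ^+ (m - d) = P ^+ 2 * T ^+ 2 * D.
    by rewrite -exprM -!exprD; congr (_ ^+ _); (clear - m4 mM d_gt1; lia).
  have Pmm2d : P ^+ (m - 2 * d) = P ^+ 2 * T ^+ 2.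
    by rewrite -exprM -!exprD; congr (_ ^+ _); (clear - m4 mM d_gt1; lia).
  rewrite Pm Pm1 PMs PM PMd PMd1 PM1 PMmd1 PMmd Pmmd Pmm2d.
  by split.
(* A positive multiple [l] of [d] below [2 * d] must be [d] itself, so this is the subfield case. *)
move=> m2d; have lm : (l.*2 = m)%N.
  have /dvdnP[k lk] := d_l; move: l_lt l_ge1; rewrite m2d lk ltn_pmul2r //.
  by case: k {lk} => [|[|k]] // _ _; rewrite mul1n mul2n.
have ld : l = d by clear - lm m2d; lia.
have roots (u : 'F_p) : u != 0 -> exists2 v : F, v != 0 & v ^+ (p ^ l).+1 = emb F u.
  apply: (ex_root_Fp p_pr cardF (e := d)); first by rewrite m2d.
  rewrite (@gcd_even_quot p m p_pr l d) //; first by rewrite ld divnn d_gt0.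
  by rewrite -m2d ld m2d gcdnn.
have lE : (p ^ l)%N%:Z = p%:Z * (p ^ (d - 1))%N%:Z.
  by rewrite pM; congr (Posz (_ ^ _)); (clear - m2d ld d_gt1; lia).
have rE : (p ^ (m - 1))%N%:Z = p%:Z * (p ^ (d - 1))%N%:Z ^+ 2.
  by rewrite sqrM pM; congr (Posz (_ ^ _)); (clear - m2d ld d_gt1; lia).
have le1 : p%:Z * (p ^ (d - 1))%N%:Z <= (p ^ (m - 2))%N%:Z by rewrite pM leE;
  (clear - m2d ld d_gt1; lia).
have le2 : (p ^ (d - 1))%N%:Z <= (p ^ (m - 3))%N%:Z by rewrite leE;
  (clear - m2d ld d_gt1; lia).
have m_gt2 : (2 < m)%N by (clear - m2d ld d_gt1; lia).
have [h1 h2 h3] := designs_subfield p_pr cardF p_odd l_lt m_gt2 lm roots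
  (pow_gt0 (d - 1)%N) (powR (d - 1)%N) lE rE le1 le2.
set W := P ^+ (d - 1) in h1 h2 h3 *.
have Pm1 : P ^+ (m - 1) = P * W ^+ 2 by rewrite -exprM -exprS; congr (_ ^+ _);
  (clear - m2d ld d_gt1; lia).
have Pm : P ^+ m = P * (P * W ^+ 2) by rewrite -Pm1 -exprS; congr (_ ^+ _);
  (clear - m2d ld d_gt1; lia).
have -> : (m %/ 2 = d)%N by (clear - m2d ld d_gt1; lia).
have Pd : P ^+ d = P * W by rewrite -exprS; congr (_ ^+ _); (clear - m2d ld d_gt1; lia).
have Pd1 : P ^+ (d + 1) = P ^+ 2 * W by rewrite exprD Pd expr1; ring.
rewrite Pm Pm1 Pd1 Pd.
by split.
Qed.
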